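(* Every finitely generated group $G$ with an element of infinite order admits a Cayley graph $(G,S)$ with discrete group of isometries. If in addition $G$ is finitely presented, then $(G,S)$ is USLG-rigid.
   Context: A ''graph'' means a connected, locally finite graph without loops or multiple edges, equipped with the geodesic metric giving each edge length $1$; ''$x\in X$'' means that $x$ is a vertex of $X$; balls are closed balls. The isometry group of a graph is equipped with the topology of pointwise convergence; it is discrete if and only if its vertex stabilizers are finite. A covering from a graph $X$ to a graph $Y$ is a graph covering map (a surjective graph morphism which, for every vertex $x$, maps the neighbors of $x$ bijectively onto the neighbors of its image). Given a finitely generated group $G$ and a finite symmetric generating set $S$, the Cayley graph $(G,S)$ is the graph with vertex set $G$ and distance $d(g,h)=|g^{-1}h|_S$ (word length). Given a graph $X$ and $R>0$, a graph $Y$ is $R$-locally $X$ if for every vertex $y\in Y$ there exists $x\in X$ such that the balls $B_X(x,R)$ and $B_Y(y,R)$, equipped with their intrinsic geodesic metrics, are isometric. For $0<r\le R$, $X$ is USLG-rigid at scales $(r,R)$ if for every graph $Y$ which is $R$-locally $X$ and every isometry $f$ from a ball $B(x,R)$ in $X$ to a ball $B(y,R)$ in $Y$, the restriction of $f$ to $B(x,r)$ extends to a covering from $X$ to $Y$, and this covering is unique. $X$ is USLG-rigid if for all large enough $r$ there exists $R$ such that $X$ is USLG-rigid at scales $(r,R)$. *)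

(* Defs.v *)
(* MathComp / MathComp-Analysis development. *)
From HB Require Import structures.
From mathcomp Require Import all_boot all_order all_algebra.
From mathcomp Require Import all_classical all_reals topology.

Set Implicit Arguments.
Unset Strict Implicit.
Unset Printing Implicit Defensive.

Import Order.TTheory GRing.Theory Num.Theory.

Local Open Scope classical_set_scope.
Local Open Scope nat_scope.

(* The value 0 when [P] is empty is never used below: graphs are connected,
   so are their balls, and words in a generating set reach every element. *)
Definition least (P : nat -> Prop) : nat :=
  if pselect (exists n, `[< P n >]) is left h then ex_minn h else 0.

Definition gdist (V : Type) (e : rel V) (u v : V) : nat :=
  least (fun n => exists p, [/\ path e u p, last u p = v & size p = n]).

Record graph := Graph {
  vertex :> choiceType;
  adj : rel vertex;
  adj_sym : symmetric adj;
  adj_irr : irreflexive adj;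
  adj_connected : forall u v, exists p, path adj u p /\ last u p = v;
  adj_locally_finite : forall u, finite_set [set v | adj u v]
}.

Definition dist (X : graph) (u v : X) : nat := gdist (@adj X) u v.

(* Isometries of a graph are isometries of its vertex set for [dist], which is
   the restriction to vertices of the metric giving each edge length 1. *)
Definition isometry (X : graph) (f : X -> X) : Prop :=
  set_bij setT setT f /\ forall u v, dist (f u) (f v) = dist u v.

(* The isometries, in the pointwise convergence topology on self-maps of the
   discrete space of vertices, form a discrete subspace. *)
Definition discrete_isometry_group (X : graph) : Prop :=
  let Isom : set {ptws X -> discrete_topology X} := [set f | isometry f] in
  Isom `<=` isolated Isom.

Definition covering (X Y : graph) (f : X -> Y) : Prop :=
  set_surj setT setT f /\
  forall x, set_bij [set u | adj x u] [set v | adj (f x) v] f.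

Section Balls.
Context {K : realType}.
Implicit Types X Y : graph.

Definition gball X (x : X) (r : K) : set X := [set u | ((dist x u)%:R <= r)%R].

(* The edge {u, v} is contained in the closed ball of radius [r] of the metric
   graph iff its point farthest from [x], which lies at distance
   (d(x,u) + d(x,v) + 1) / 2, is in that ball. For integral [r], edges between
   two vertices at distance exactly [r] are thus excluded. *)
Definition ball_adj X (x : X) (r : K) : rel X := fun u v =>
  adj u v && (((dist x u + dist x v + 1)%N%:R / 2 <= r)%R).

Definition ball_dist X (x : X) (r : K) (u v : X) : nat :=
  gdist (ball_adj x r) u v.

(* Only the restriction of [f] to the ball matters; [f x = y] is not
   required. *)
Definition ball_isometry X Y (x : X) (y : Y) (r : K) (f : X -> Y) : Prop :=
  set_bij (gball x r) (gball y r) f /\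
  {in gball x r &, forall u v,
    ball_dist y r (f u) (f v) = ball_dist x r u v}.

Definition locally_like (R : K) X Y : Prop :=
  forall y : Y, exists (x : X) (f : X -> Y), ball_isometry x y R f.

Definition USLG_rigid_at X (r R : K) : Prop :=
  [/\ (0 < r)%R, (r <= R)%R &
   forall Y : graph, locally_like R X Y ->
   forall (x : X) (y : Y) (f : X -> Y), ball_isometry x y R f ->
     exists! phi : X -> Y, covering phi /\ {in gball x r, phi =1 f}].

End Balls.

Definition USLG_rigid (K : realType) (X : graph) : Prop :=
  exists r0 : K, forall r, (r0 <= r)%R -> exists R, USLG_rigid_at X r R.

Section Groups.
Local Open Scope group_scope.

Definition infinite_order (G : groupType) (g : G) : Prop :=
  forall n : nat, (0 < n)%N -> g ^+ n != 1.

Definition finitely_generated (G : groupType) : Prop :=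
  exists S : seq G, forall g : G, exists w : seq G,
    all (fun s => (s \in S) || (s^-1 \in S)) w /\ \prod_(s <- w) s = g.

(* Words over an alphabet and its formal inverses: [(a, true)] stands for the
   inverse of [a]. *)
Definition word (A : Type) := seq (A * bool).

Definition word_eval (G : groupType) (A : Type) (gen : A -> G) (w : word A)
    : G :=
  \prod_(l <- w) (if l.2 then (gen l.1)^-1 else gen l.1).

(* Equality of words in the group presented by <A | rels>. *)
Inductive presented_eq (A : eqType) (rels : seq (word A)) :
    word A -> word A -> Prop :=
| PresRefl u : presented_eq rels u u
| PresSym u v : presented_eq rels u v -> presented_eq rels v u
| PresTrans u v w :
    presented_eq rels u v -> presented_eq rels v w -> presented_eq rels u w
| PresCancel u v a b : presented_eq rels (u ++ (a, b) :: (a, ~~ b) :: v) (u ++ v)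
| PresRel u v r : r \in rels -> presented_eq rels (u ++ r ++ v) (u ++ v).

Definition finitely_presented (G : groupType) : Prop :=
  exists (n : nat) (gen : 'I_n -> G) (rels : seq (word 'I_n)),
    (forall g, exists w, word_eval gen w = g) /\
    (forall u v, word_eval gen u = word_eval gen v <-> presented_eq rels u v).

Section Cayley.
Variables (G : groupType) (S : seq G).

Definition symmetric_generating : Prop :=
  {in S, forall s, s^-1 \in S} /\
  forall g : G, exists w : seq G, all (mem S) w /\ \prod_(s <- w) s = g.

Definition word_length (g : G) : nat :=
  least (fun n => exists w : seq G,
    [/\ all (mem S) w, \prod_(s <- w) s = g & size w = n]).

Definition cayley_adj : rel G := fun g h => (g != h) && (g^-1 * h \in S).

Hypothesis genS : symmetric_generating.

Lemma cayley_adj_sym : symmetric cayley_adj.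
Proof.
have half g h : cayley_adj g h -> cayley_adj h g.
  case/andP=> gh /(proj1 genS); rewrite invgM invgK => hg.
  by rewrite /cayley_adj eq_sym gh hg.
by move=> g h; apply/idP/idP; exact: half.
Qed.

Lemma cayley_adj_irr : irreflexive cayley_adj.
Proof. by move=> g; rewrite /cayley_adj eqxx. Qed.

Lemma cayley_path_of_word (w : seq G) (g : G) : all (mem S) w ->
  exists p, [/\ path cayley_adj g p, last g p = g * \prod_(s <- w) s &
    (size p <= size w)%N].
Proof.
elim: w g => [|s w IH] g /=; first by exists [::]; rewrite big_nil mulg1.
case/andP=> sS /(IH (g * s)) [p [pp pl ps]]; rewrite big_cons mulgA.
have [e|ne] := eqVneq g (g * s); last first.
  exists (g * s :: p); split=> //=.
  by rewrite pp /cayley_adj ne mulKg; move: sS => /= ->.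
by exists p; rewrite {1 2}e; split=> //; exact: leqW.
Qed.

Lemma cayley_word_of_path (p : seq G) (g : G) : path cayley_adj g p ->
  exists w, [/\ all (mem S) w, \prod_(s <- w) s = g^-1 * last g p &
    size w = size p].
Proof.
elim: p g => [|h p IH] g /=; first by exists [::]; rewrite big_nil mulVg.
case/andP=> /andP[_ ghS] /IH[w [wS wp ws]]; exists (g^-1 * h :: w).
by rewrite big_cons wp /= ghS wS ws mulgA mulgK.
Qed.

Lemma cayley_connected g h : exists p, path cayley_adj g p /\ last g p = h.
Proof.
have [w [wS wp]] := proj2 genS (g^-1 * h).
have [p [pp pl _]] := cayley_path_of_word g wS.
by exists p; rewrite pl wp mulVKg.
Qed.

Lemma cayley_locally_finite g : finite_set [set h | cayley_adj g h].
Proof.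
apply: (@sub_finite_set _ _ [set` [seq g * s | s <- S]]); last first.
  exact: finite_seq.
by move=> h /= /andP[_ hS]; apply/mapP; exists (g^-1 * h); rewrite ?mulVKg.
Qed.

Definition cayley : graph :=
  Graph cayley_adj_sym cayley_adj_irr cayley_connected cayley_locally_finite.

Lemma leastP (P : nat -> Prop) : (exists n, P n) ->
  P (least P) /\ forall n, P n -> (least P <= n)%N.
Proof.
move=> [n Pn]; rewrite /least; case: pselect => [h|[]]; last first.
  by exists n; apply/asboolP.
case: ex_minnP => m /asboolP Pm min; split=> // k Pk.
by apply: min; apply/asboolP.
Qed.

(* The path metric of the Cayley graph is the word metric. *)
Lemma cayley_dist (g h : cayley) : dist g h = word_length (g^-1 * h).
Proof.
rewrite /dist /gdist /word_length.
set P := (X in least X); set Q := (X in _ = least X).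
have [|[p [pp pl ps]] minP] := @leastP P.
  by have [p [pp pl]] := cayley_connected g h; exists (size p), p.
have [|[w [wS wp ws]] minQ] := @leastP Q.
  by have [w [wS wp]] := proj2 genS (g^-1 * h); exists (size w), w.
apply/eqP; rewrite eqn_leq; apply/andP; split.
  have [q [qp ql qs]] := cayley_path_of_word g wS.
  rewrite -ws; apply: leq_trans qs; apply: minP; exists q; split=> //.
  by rewrite ql wp mulVKg.
have [v [vS vp vs]] := cayley_word_of_path pp.
by rewrite -ps -vs; apply: minQ; exists v; rewrite vp pl.
Qed.

End Cayley.
End Groups.

(* Main.v *)
Require Import Defs.
From mathcomp Require Import all_boot all_order all_algebra.
From mathcomp Require Import all_classical all_reals topology lra zify.

Set Implicit Arguments.
Unset Strict Implicit.
Unset Printing Implicit Defensive.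

Local Open Scope group_scope.

(** Let S be a finite symmetric generating set containing 1 and an element of
infinite order z, and let T be the set of products of three elements of S. A
high power u of z adds to a finite symmetric set A of labels the four labels
u, u^-1, u^-1 t, t^-1 u; this creates triangles on the edges labelled t and on
(almost) no other edge, while each new edge lies in few triangles. Iterating,
one gets A containing T such that the number of triangles on an edge labelled
in T determines the label up to inversion. Maps that are injective on stars
therefore preserve the labels in T up to inversion, and a computation with the
labels S, S^2, S^3 shows that two of them which agree on S agree on S^2: the
exceptional configurations generate a quaternion group, and are excluded by z.
Hence an isometry is determined by its restriction to S.

If G is finitely presented and Y is locally X, ball isometries give charts of Y
by X. A local covering of X of large radius agrees on S with a global one,
because there are finitely many germs, so that a chart can be continued from a
vertex to its neighbours indefinitely. By the uniqueness above, the
continuation along a word depends only on the word up to the relators, hence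
only on the group element, and it is a covering. *)

(** * Separating labels by triangle counts *)

Lemma injective_eventually_notin (T : eqType) (f : nat -> T) (s : seq T) :
  injective f -> exists n0, forall n, (n0 <= n)%N -> f n \notin s.
Proof.
move=> injf; elim: s => [|x s [n0 IH]]; first by exists 0.
have [[m fm]|nof] := boolp.EM (exists m, f m = x).
  exists (maxn m.+1 n0) => n; rewrite geq_max inE negb_or => /andP[mn /IH ->].
  rewrite andbT -fm; apply/eqP => /injf nm.
  by rewrite nm ltnn in mn.
exists n0 => n /IH fn; rewrite inE negb_or fn andbT.
by apply/eqP => fnx; apply: nof; exists n.
Qed.

Section GrowingTriangles.
Variable G : groupType.
Implicit Types (A U : seq G) (a b t u z : G).

(* The closed neighbourhoods of 1 and a in the Cayley graph of A meet in
   [ntri A a] vertices. *)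
Definition ntri A a := count (fun b => a^-1 * b \in A) A.

Lemma ntriV A a : uniq A -> ntri A a^-1 = ntri A a.
Proof.
move=> uA; have le b : (ntri A b^-1 <= ntri A b)%N.
  rewrite /ntri -!size_filter -(size_map ( *%g b)).
  apply: uniq_leq_size => [|c /mapP[d]].
    by rewrite map_inj_uniq ?filter_uniq//; exact: mulgI.
  by rewrite !mem_filter invgK => /andP[bd dA] ->; rewrite mulKg dA.
by apply/eqP; rewrite eqn_leq le -{1}[a]invgK le.
Qed.

Lemma infinite_order_expg_inj z : infinite_order z -> injective (natexp z).
Proof.
move=> zinf.
have lt m n : (m < n)%N -> z ^+ m <> z ^+ n.
  move=> mn /(congr1 (fun x => z ^- m * x)).
  rewrite mulVg -(subnKC (ltnW mn)) expgnDr mulKg => /esym.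
  by apply/eqP/zinf; rewrite subn_gt0.
move=> m n e; case: (ltngtP m n) => // [/lt//|/lt/(_ (esym e))//].
Qed.

(** With [conj_power_inj], this moves [u * t^-1 * u] and [u^-1 * t * u] out of any finite set for a
    high power [u] of [z], unless [t] inverts or centralizes some power of [z]. *)
Lemma sandwich_inj z t : (forall k, (0 < k)%N -> z ^+ k * t * z ^+ k != t) ->
  injective (fun n => z ^+ n * t^-1 * z ^+ n).
Proof.
move=> noinv.
have lt m n : (m < n)%N -> z ^+ m * t^-1 * z ^+ m <> z ^+ n * t^-1 * z ^+ n.
  move=> mn; rewrite -(subnK (ltnW mn)); set k := (n - m)%N.
  rewrite {1}expgnDr addnC expgnDr => e.
  have {}e : t^-1 = z ^+ k * t^-1 * z ^+ k.
    apply: (@mulIg _ (z ^+ m)); apply: (@mulgI _ (z ^+ m)).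
    rewrite !mulgA e !mulgA.
    by rewrite -!expgnDr addnC -!mulgA -!expgnDr addnC.
  have /eqP[] := noinv k (ltac:(by rewrite subn_gt0)).
  move: e => /(congr1 (fun x => x^-1)); rewrite !invgM !invgK mulgA => e.
  by rewrite {1}e !mulgA mulgV mul1g mulgVK.
move=> m n e; case: (ltngtP m n) => // [/lt//|/lt/(_ (esym e))//].
Qed.

Lemma conj_power_inj z t :
  (forall k, (0 < k)%N -> z ^+ k * t != t * z ^+ k) ->
  injective (fun n => z ^- n * t * z ^+ n).
Proof.
move=> nocomm.
have lt m n : (m < n)%N -> z ^- m * t * z ^+ m <> z ^- n * t * z ^+ n.
  move=> mn; rewrite -(subnK (ltnW mn)); set k := (n - m)%N.
  rewrite expgnDr invgM !mulgA => /mulIg.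
  rewrite -!mulgA => /mulgI e.
  have /eqP[] := nocomm k (ltac:(by rewrite subn_gt0)).
  by rewrite {1}e mulVKg.
move=> m n e; case: (ltngtP m n) => // [/lt//|/lt/(_ (esym e))//].
Qed.

(* Adding u, u^-1, u^-1 t and t^-1 u for a high power u of z puts the edges
   labelled t in one more triangle, and the new edges in at most 8 triangles.
   When t inverts z, the identity (u^-1 t)^2 = t^2 makes t^2 an exception. *)
Lemma increase_ntri A z t : uniq A -> 1 \in A -> {in A, forall a, a^-1 \in A} ->
  t \in A -> infinite_order z ->
  (forall k, (0 < k)%N -> z ^+ k * t = t * z ^+ k -> z * t = t * z) ->
  (forall k, (0 < k)%N -> z ^+ k * t * z ^+ k = t -> z * t * z = t) ->
  exists A', [/\ uniq A', {subset A <= A'} & {in A', forall a, a^-1 \in A'}] /\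
  [/\ forall b c, b \in A -> c \in A -> b * c \in A' -> b * c \in A,
      {in A', forall a, a \notin A -> (ntri A' a <= 8)%N},
      {in A, forall a, a != 1 -> a != t -> a != t^-1 ->
         (z * t * z = t -> a != t * t /\ a != (t * t)^-1) ->
         ntri A' a = ntri A a} &
      (ntri A t < ntri A' t)%N].
Proof.
move=> uA A1 AV At zinf comm inv.
(* A coincidence between old and new labels would put [u], [u * u], [u * t^-1 * u] or [u^-1 * t * u]
   into [A3]. A large exponent [n] excludes this, except when one of the last two products is
   identically [t^-1] or [t]. *)
pose A3 := [seq x * d | x <- [seq b * c | b <- A, c <- A], d <- A].
have A3P b c d : b \in A -> c \in A -> d \in A -> b * c * d \in A3.
  by move=> bA cA dA; apply: allpairs_f => //; exact: allpairs_f.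
have A2P b c : b \in A -> c \in A -> b * c \in A3.
  by move=> bA cA; rewrite -[b * c]mulg1 A3P.
have A1P b : b \in A -> b \in A3 by move=> bA; rewrite -[b]mulg1 A2P.
have A3V b : b \in A3 -> b^-1 \in A3.
  case/allpairsP=> -[x d] /= [/allpairsP[[b1 c1] /= [b1A c1A ->]] dA ->].
  by rewrite !invgM mulgA A3P ?AV.
have zinj := infinite_order_expg_inj zinf.
have [n0 n0P] := injective_eventually_notin A3 zinj.
have z2inj : injective (fun n => z ^+ n * z ^+ n).
  by move=> m n; rewrite -!expgnDr => /zinj; rewrite !addnn => /double_inj.
have [n1 n1P] := injective_eventually_notin A3 z2inj.
have [n2 n2P] : exists n2, forall n, (n2 <= n)%N ->
    z * t * z = t \/ z ^+ n * t^-1 * z ^+ n \notin A3.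
  have [tz|tz] := eqVneq (z * t * z) t; first by exists 0 => *; left.
  have [|n2 n2P] := @injective_eventually_notin _ _ A3 (@sandwich_inj z t _).
    by move=> k k0; apply: contra_neq tz => /(inv _ k0).
  by exists n2 => n /n2P; right.
have [n3 n3P] : exists n3, forall n, (n3 <= n)%N ->
    z * t = t * z \/ z ^- n * t * z ^+ n \notin A3.
  have [tz|tz] := eqVneq (z * t) (t * z); first by exists 0 => *; left.
  have [|n3 n3P] := @injective_eventually_notin _ _ A3 (@conj_power_inj z t _).
    by move=> k k0; apply: contra_neq tz => /(comm _ k0).
  by exists n3 => n /n3P; right.
pose n := maxn (maxn n0 n1) (maxn n2 n3).
have {n0P}uA3 : z ^+ n \notin A3 by apply: n0P; rewrite !leq_max leqnn.
have {n1P}u2A3 : z ^+ n * z ^+ n \notin A3.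
  by apply: n1P; rewrite !leq_max leqnn !orbT.
have {n2P}n2P : z * t * z = t \/ z ^+ n * t^-1 * z ^+ n \notin A3.
  by apply: n2P; rewrite !leq_max leqnn !orbT.
have {n3P}n3P : z * t = t * z \/ z ^- n * t * z ^+ n \notin A3.
  by apply: n3P; rewrite !leq_max leqnn !orbT.
have {n2P} utu : z * t * z = t /\ z ^+ n * t^-1 * z ^+ n = t^-1 \/
    z ^+ n * t^-1 * z ^+ n \notin A3.
  case: n2P => [tz|]; [left; split=> // | by right].
  elim: n {uA3 u2A3 n3P} => [|k IH]; first by rewrite mul1g mulg1.
  have tzV : z * t^-1 * z = t^-1.
    by rewrite -{1}tz !invgM !mulgA mulgV mul1g mulgVK.
  by rewrite {1}expgSr expgS -[in RHS]IH -[in RHS]tzV !mulgA.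
have {n3P} utu' : z ^- n * t * z ^+ n = t \/ z ^- n * t * z ^+ n \notin A3.
  case: n3P => [tz|]; [left | by right].
  by rewrite -mulgA (commuteX n (esym tz : commute t z)) mulKg.
move: (z ^+ n) uA3 u2A3 utu utu' => u uA3 u2A3 utu ut.

pose U := undup [:: u; u^-1; u^-1 * t; t^-1 * u].
have UV : {in U, forall x, x^-1 \in U}.
  move=> x; rewrite !mem_undup !inE => /or4P[]/eqP ->;
  by rewrite ?invgM ?invgK !eqxx ?orbT.
have A2V b c : b \in A -> c \in A -> b * c \in U -> False.
  move=> bA cA; rewrite mem_undup !inE => /or4P[]/eqP e; move: uA3.
  - by rewrite -e A2P.
  - by rewrite -[u]invgK -e A3V// A2P.
  - by rewrite -[u]invgK -[u^-1](mulgK t) -e A3V// A3P ?AV.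
  - by rewrite -[u](mulVKg t) -e mulgA A3P.
have AU x : x \in A -> x \in U -> False.
  by rewrite -{2}[x]mulg1 => xA; exact: A2V.
pose A' := U ++ A.
have uA' : uniq A'.
  rewrite cat_uniq undup_uniq uA andbT /=; apply/hasPn => x xA; apply/negP.
  exact: AU.
have memA' b c : b \in A -> c \in A -> (b * c \in A') = (b * c \in A).
  move=> bA cA; rewrite mem_cat orbC; case: (boolP (_ \in A)) => //= _.
  by apply/negP; exact: A2V.
have memU b c : b \in A -> c \in U -> (b * c \in A') = (b * c \in U).
  move=> bA cU; rewrite mem_cat; case: (boolP (_ \in U)) => //= _.
  apply/negP => bcA; apply: (@A2V b^-1 (b * c)); rewrite ?AV//.
  by rewrite mulKg.
have ntriA' a : a \in A ->
    ntri A' a = (count (fun b => (a^-1 * b)%g \in U) U + ntri A a)%N.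
  move=> aA; rewrite /ntri count_cat; congr addn; apply: eq_in_count => b bX.
    by rewrite memU ?AV.
  by rewrite memA' ?AV.
have sizeU : (size U <= 4)%N by exact: size_undup.
have utuA : u * t^-1 * u \in A3 -> z * t * z = t /\ u * t^-1 * u = t^-1.
  by case: utu => [//|/negP].
have utuV : u^-1 * t * u^-1 = (u * t^-1 * u)^-1.
  by rewrite !invgM invgK mulgA.
have utA : u^-1 * t * u \in A3 -> u^-1 * t * u = t by case: ut => [//|/negP].
have utV : u^-1 * t^-1 * u = (u^-1 * t * u)^-1.
  by rewrite !invgM invgK mulgA.
(* A triangle with an old edge labelled [a] and two new edges writes [a] as a product of two
   elements of [U]. *)
have UUA b c : b \in U -> c \in U -> b * c \in A ->
    [\/ b * c = 1, b * c = t, b * c = t^-1 |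
     z * t * z = t /\ (b * c = t * t \/ b * c = (t * t)^-1)].
  rewrite !mem_undup !inE => /or4P[]/eqP -> /or4P[]/eqP ->;
    rewrite ?(mulgV, mulVg, mulgK, mulgVK, mulKg, mulVKg, mulgA);
    try by [constructor 1 | constructor 2 | constructor 3].
  - by move/A1P; rewrite (negPf u2A3).
  - by move/A1P/utuA => [_ ->]; constructor 3.
  - by rewrite -invgM => /A1P/A3V; rewrite invgK (negPf u2A3).
  - move=> /AV h; move: (A2P _ _ At h).
    by rewrite !invgM !invgK mulVKg (negPf u2A3).
  - rewrite utV => /A1P/A3V; rewrite invgK => /utA ->; by constructor 3.
  - by move/A1P/utA ->; constructor 2.
  - rewrite utuV => /A1P/A3V; rewrite invgK => /utuA[_ ->].
    by rewrite invgK; constructor 2.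
  - move=> h; move: (A2P _ _ h (AV _ At)); rewrite mulgK utuV => /A3V.
    rewrite invgK => /utuA[tz ->]; rewrite invgK; constructor 4.
    by split=> //; left.
  - by move/(A2P _ _ At); rewrite !mulgA mulgV mul1g (negPf u2A3).
  - move=> h; have /utuA[tz e] : u * t^-1 * u \in A3.
      by have := A2P _ _ At h; rewrite -!mulgA mulVKg.
    constructor 4; split=> //; right.
    by rewrite -2!mulgA [u * _]mulgA e invgM.
exists A'; split=> //.
- by split=> // [x xA|x]; rewrite ?mem_cat ?xA ?orbT// => /orP[/UV|/AV] ->;
    rewrite ?orbT.
split=> [b c bA cA|a|a aA a1 at_ atV att|].
- by rewrite memA'.
- rewrite mem_cat => /orP[aU _|->//].
  (* In a triangle on a new edge another edge is new too: at most 4 third vertices are reached by a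
     new label from one end, and at most 4 from the other. *)
  rewrite /ntri count_cat -[8%N]/(4 + 4)%N leq_add//.
    by apply: leq_trans sizeU; exact: count_size.
  apply: leq_trans sizeU; rewrite -size_filter -(size_map ( *%g a^-1)).
  apply: uniq_leq_size => [|c /mapP[b]].
    by rewrite map_inj_uniq ?filter_uniq//; exact: mulgI.
  rewrite mem_filter => /andP[+ bA ->]; rewrite mem_cat => /orP[//|abA].
  by case: (@A2V b (a^-1 * b)^-1); rewrite ?AV// invgM invgK mulVKg.
- rewrite ntriA' //; apply/eqP; rewrite -[X in _ == X]add0n eqn_add2r.
  rewrite -leqn0 leqNgt -has_count; apply/hasPn => b bU; apply/negP => abU.
  have := UUA _ _ bU (UV _ abU); rewrite invgM invgK mulVKg => /(_ aA).
  case=> [||| [/att[/eqP tt1 /eqP tt2]] []//]; exact/eqP.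
- rewrite ntriA' // -[X in (X < _)%N]add0n ltn_add2r -has_count.
  by apply/hasP; exists u; rewrite mem_undup !inE !eqxx ?orbT.
Qed.
End GrowingTriangles.

(** Used to replace [z] by a power of it for which any relation with an element of a finite set that
    holds for some further power holds already. *)
Lemma common_multiple (T : eqType) (s : seq T) (P : T -> nat -> Prop) :
  (forall x j k, P x k -> P x (k * j)%N) ->
  exists2 m, (0 < m)%N &
    {in s, forall x k, (0 < k)%N -> P x k -> P x m}.
Proof.
move=> Pmul; elim: s => [|x s [m m0 IH]]; first by exists 1%N.
have [[k [k0 Pk]]|noP] := boolp.EM (exists k, (0 < k)%N /\ P x k).
  exists (k * m)%N; first by rewrite muln_gt0 k0.
  move=> y; rewrite inE => /predU1P[-> l l0 _|ys l l0 Py]; first exact: Pmul.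
  by rewrite mulnC; apply: Pmul; exact: IH Py.
exists m => // y; rewrite inE => /predU1P[-> l l0 Py|]; last exact: IH.
by case: noP; exists l.
Qed.

(** * Separating all labels of a finite set *)

Section Separation.
Variables (G : groupType) (T : seq G).
Hypotheses (T1 : 1 \in T) (TV : {in T, forall t, t^-1 \in T}).
Implicit Types (A l : seq G) (a s t z : G).

(** [l] lists the labels already separated. The bound 8 is that of [increase_ntri] for new labels;
    the condition on products keeps an exceptional label [t * t] of [A] inside [T], so that the
    counts of old labels outside [T] do not change. *)
Definition separated A l :=
  [/\ uniq A, {subset T <= A}, {in A, forall a, a^-1 \in A},
      {in T &, forall s t, s * t \in A -> s * t \in T} &
      {in A, forall a, a \notin T -> (ntri A a <= 8)%N}] /\
  [/\ {in l, forall t, [/\ t \in T, t != 1 & (8 < ntri A t)%N]} &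
      {in l &, forall s t, ntri A s = ntri A t -> t = s \/ t = s^-1}].

Section Power.
Variable z : G.
Hypotheses (zinf : infinite_order z)
  (zcomm : {in T, forall t k, (0 < k)%N ->
     z ^+ k * t = t * z ^+ k -> z * t = t * z})
  (zinv : {in T, forall t k, (0 < k)%N ->
     z ^+ k * t * z ^+ k = t -> z * t * z = t}).

(** If [t] inverts [z], then [t * t] commutes with [z]; if it also inverted [z], then
    [z ^+ 2 = 1]. *)
Lemma square_not_inverted t : z * t * z = t -> z * (t * t) * z <> t * t.
Proof.
move=> tz e; have /eqP[] := zinf (isT : (0 < 2)%N).
have zt : z * t = t * z^-1 by rewrite -{2}tz mulgK.
have zVt : z^-1 * t = t * z by rewrite -{1}tz !mulgA mulVg mul1g.
apply: (@mulgI _ (t * t)); rewrite mulg1 -[RHS]e !mulgA zt.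
by rewrite -[t * z^-1 * t]mulgA zVt !mulgA.
Qed.

(** The count of [t] is positive and each application of [increase_ntri] raises it, so [m] of them
    push it above [m]. *)
Lemma separated_raise A l t m : separated A l -> t \in T -> t != 1 ->
  t \notin l -> t^-1 \notin l ->
  (z * t * z = t -> {in l, forall s, z * s * z = s}) ->
  exists A', [/\ separated A' l, {in l, forall s, ntri A' s = ntri A s} &
    (m < ntri A' t)%N].
Proof.
move=> sepA tT t1 tl tVl invl; elim: m => [|m [A' [sepA' eqA' mt]]].
  exists A; split=> //.
  case: sepA => -[uA TA _ _ _] _; rewrite -has_count.
  by apply/hasP; exists t; rewrite ?mulVg TA.
case: sepA' => -[uA TA AV A2 A8] [lA linj].
have [A'' [[uA' sAA' AV'] [A2' A8' eqA lt]]] := increase_ntri uA (TA _ T1) AV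
  (TA _ tT) zinf (zcomm tT) (zinv tT).
have eql : {in l, forall s, ntri A'' s = ntri A' s}.
  move=> s sl; have [sT s1 _] := lA _ sl; apply: eqA => //; first exact: TA.
  - by apply: contraNneq tl => <-.
  - by apply: contraNneq tVl => <-.
  (* If [t] inverts [z], so does [s], whereas [t * t] and its inverse do not: [s] is not
     exceptional. *)
  move=> tz; have sz := invl tz _ sl.
  split; apply/eqP => es; rewrite es in sz.
    exact: square_not_inverted sz.
  apply: (square_not_inverted tz).
  by rewrite -{1}[t * t]invgK -{1}sz !invgM !invgK !mulgA mulgV mul1g mulgVK.
exists A''; split; [split; split=> // | by move=> s sl; rewrite eql ?eqA' | ].
- by move=> s sT; exact: sAA' (TA _ sT).
- by move=> b c bT cT /(A2' _ _ (TA _ bT) (TA _ cT)); exact: A2.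
- move=> a aA'' aT; have [aA|] := boolP (a \in A'); last exact: A8'.
  rewrite eqA //; first exact: A8.
  + by apply: contraNneq aT => ->.
  + by apply: contraNneq aT => ->.
  + by apply: contraNneq aT => ->; exact: TV.
  + move=> _; split; apply: contraNneq aT => ea; move: aA; rewrite ea.
      exact: A2.
    by rewrite invgM; apply: A2; exact: TV.
- by move=> s sl; rewrite eql //; exact: lA.
- by move=> r s rl sl; rewrite !eql //; exact: linj.
- exact: leq_ltn_trans lt.
Qed.

(* The labels inverted by z have to be added first: an exceptional t^2 commutes
   with z, so it is not among the labels separated before t. *)
Lemma separated_cons A l t : separated A l -> t \in T -> t != 1 ->
  (z * t * z = t -> {in l, forall s, z * s * z = s}) ->
  exists A', separated A' (t :: l).
Proof.
move=> sepA tT t1 invl.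
have [ttl|] := boolP ((t \in l) || (t^-1 \in l)).
  exists A; case: sepA => -[uA TA AV A2 A8] [lA linj]; split; split=> //.
    move=> s; rewrite inE => /predU1P[->|]; last exact: lA.
    by case/orP: ttl => /lA[_ _]; rewrite ?ntriV.
  have tneq s : s \in l -> ntri A t = ntri A s -> s = t \/ s = t^-1.
    case/orP: ttl => [tl sl|tl sl]; first exact: linj.
    by rewrite -ntriV // => /(linj _ _ tl sl); rewrite invgK => -[]; auto.
  move=> r s; rewrite !inE => /predU1P[->|rl] /predU1P[->|sl]; first by left.
  - exact: tneq.
  - move/esym/(tneq _ rl) => -[]->; first by left.
    by right; rewrite invgK.
  - exact: linj.
rewrite negb_or => /andP[tl tVl].
pose m := foldr maxn 8 [seq ntri A s | s <- l].
have m8 : (8 <= m)%N.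
  by rewrite /m; elim: (map _ _) => //= n q IH; rewrite leq_max IH orbT.
have lem s : s \in l -> (ntri A s <= m)%N.
  rewrite /m => sl; have {sl}: ntri A s \in map (ntri A) l by exact: map_f.
  elim: (map _ _) => //= n q IH; rewrite inE leq_max => /predU1P[->|/IH->].
    by rewrite leqnn.
  by rewrite orbT.
have [A' [[hA [lA linj]] eqA mt]] := separated_raise m sepA tT t1 tl tVl invl.
exists A'; split=> //; split.
  move=> s; rewrite inE => /predU1P[->|]; last exact: lA.
  by split=> //; exact: leq_ltn_trans mt.
have tneq s : s \in l -> ntri A' t <> ntri A' s.
  by move=> sl e; move: mt; rewrite e eqA // ltnNge lem.
move=> r s; rewrite !inE => /predU1P[->|rl] /predU1P[->|sl]; first by left.
- by move/(tneq _ sl).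
- by move/esym/(tneq _ rl).
- exact: linj.
Qed.

Lemma separated_cat A l l' : separated A l -> {in l', forall t, t \in T} ->
  {in l', forall t, t != 1} ->
  {in l', forall t, z * t * z = t -> {in l ++ l', forall s, z * s * z = s}} ->
  exists A' l'', separated A' l'' /\ l'' =i l ++ l'.
Proof.
move=> sepA; elim: l' => [|t l' IH] l'T l'1 invl.
  by exists A, l; split=> // x; rewrite cats0.
have [||u ul uz s sl|A' [l'' [sepA' ll'']]] := IH.
- by move=> u ul; apply: l'T; rewrite inE ul orbT.
- by move=> u ul; apply: l'1; rewrite inE ul orbT.
- apply: (invl u _ uz s); first by rewrite inE ul orbT.
  by move: sl; rewrite !mem_cat inE => /orP[] ->; rewrite ?orbT.
have [||tz s|A'' sepA''] := separated_cons sepA' (t := t).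
- by apply: l'T; rewrite mem_head.
- by apply: l'1; rewrite mem_head.
- rewrite ll'' => sl; apply: (invl t _ tz s); first exact: mem_head.
  by move: sl; rewrite !mem_cat inE => /orP[] ->; rewrite ?orbT.
exists A'', (t :: l''); split=> // x.
by rewrite mem_cat !inE ll'' mem_cat orbCA.
Qed.
End Power.

Lemma triangles_separate : (exists z : G, infinite_order z) ->
  exists A, [/\ uniq A, {subset T <= A}, {in A, forall a, a^-1 \in A} &
    {in T & A, forall t a, t != 1 -> a != 1 -> ntri A t = ntri A a ->
      a = t \/ a = t^-1}].
Proof.
case=> z zinf.
pose P (tb : G * bool) k :=
  if tb.2 then commute tb.1 (z ^+ k) else z ^+ k * tb.1 * z ^+ k = tb.1.
have [|m m0 zP] :=
    @common_multiple _ [seq (t, b) | t <- T, b <- [:: true; false]] P.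
  case=> t [] j k; rewrite /P /= expgnA => h; first exact: commuteX.
  move: (z ^+ k) h => y h; elim: j => [|j IH]; first by rewrite mul1g mulg1.
  by rewrite {1}expgSr expgS -[RHS]IH -[in RHS]h !mulgA.
have {}zP t b : t \in T -> forall k, (0 < k)%N ->
    P (t, b) (m * k)%N -> P (t, b) m.
  move=> tT k k0; apply: zP; last by rewrite muln_gt0 m0.
  by apply: allpairs_f => //; case: b.
(* If a power of [y] commutes with [t] or is inverted by [t], then so is [y] itself, as
   [increase_ntri] requires. *)
pose y := z ^+ m.
have yinf : infinite_order y.
  by move=> k k0; rewrite /y -expgnA; apply: zinf; rewrite muln_gt0 m0.
have ycomm : {in T, forall t k, (0 < k)%N ->
    y ^+ k * t = t * y ^+ k -> y * t = t * y}.
  move=> t tT k k0; rewrite /y -expgnA => h.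
  by apply/esym; apply: (zP t true tT k k0); exact: esym.
have yinv : {in T, forall t k, (0 < k)%N ->
    y ^+ k * t * y ^+ k = t -> y * t * y = t}.
  by move=> t tT k k0; rewrite /y -expgnA; exact: (zP t false).
have sep0 : separated (undup T) [::].
  split; split=> //; first exact: undup_uniq.
  - by move=> t; rewrite mem_undup.
  - by move=> t; rewrite !mem_undup; exact: TV.
  - by move=> s t _ _; rewrite mem_undup.
  - by move=> a; rewrite mem_undup => ->.
(* The labels that invert [y] come first; for those in [l2] the condition on exceptions is
   vacuous. *)
pose l1 := [seq t <- T | (t != 1) && (y * t * y == t)].
pose l2 := [seq t <- T | (t != 1) && (y * t * y != t)].
have [t|t|t _ _ s|A1 [k1 [sep1 k1l]]] :=
    separated_cat yinf ycomm yinv sep0 (l' := l1).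
- by rewrite mem_filter => /andP[].
- by rewrite mem_filter => /andP[/andP[]].
- by rewrite /= mem_filter => /andP[/andP[_ /eqP]].
have [t|t|t|A2 [k2 [[[uA TA AV _ A8] [k2T k2inj]] k2l]]] :=
    separated_cat yinf ycomm yinv sep1 (l' := l2).
- by rewrite mem_filter => /andP[].
- by rewrite mem_filter => /andP[/andP[]].
- by rewrite mem_filter => /andP[/andP[_ /eqP]].
exists A2; split=> // t a tT aA t1 a1 e.
have mem2 s : s \in T -> s != 1 -> s \in k2.
  move=> sT s1; rewrite k2l mem_cat k1l !mem_filter sT s1 /= andbT.
  by case: eqP.
have [aT|aT] := boolP (a \in T); first by apply: k2inj => //; exact: mem2.
have [_ _] := k2T _ (mem2 _ tT t1).
by rewrite e ltnNge A8.
Qed.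
End Separation.

Lemma inj_in_seq_surj (T : eqType) (s : seq T) (f : T -> T) :
  {in s &, injective f} -> {in s, forall x, f x \in s} ->
  {in s, forall y, exists2 x, x \in s & f x = y}.
Proof.
move=> injf fs y; rewrite -mem_undup => ys.
have uf : uniq (map f (undup s)).
  rewrite map_inj_in_uniq ?undup_uniq// => u v.
  by rewrite !mem_undup; exact: injf.
have [|_ e] :=
    uniq_min_size uf (s2 := undup s) _ (eq_leq (esym (size_map _ _))).
  by move=> _ /mapP[x xs ->]; rewrite mem_undup fs// -mem_undup.
by move: ys; rewrite -e => /mapP[x xs ->]; exists x; rewrite // -mem_undup.
Qed.

(** * Local coverings by a Cayley graph *)

Definition cnbr (Y : graph) (y u : Y) := (y == u) || adj y u.

Section LocalCoverings.
Variables (G : groupType) (A : seq G).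
Hypothesis A1 : 1 \in A.
Implicit Types (Y : graph) (a b g s t z : G).

(** The covering condition at [g] without surjectivity, which counting recovers in
    [star_inj_surj]. *)
Definition star_inj Y (F : G -> Y) g :=
  {in A, forall a, cnbr (F g) (F (g * a))} /\
  {in A &, forall a b, F (g * a) = F (g * b) -> a = b}.

Definition ball k g :=
  exists w, [/\ all (mem A) w, \prod_(a <- w) a = g & (size w <= k)%N].

Definition local_covering k Y (F : G -> Y) :=
  forall g, ball k g -> star_inj F g.

(* The neighbourhoods of radius 1 of Y embed in that of 1 in the Cayley graph
   of A, which bounds from above their numbers of vertices and of edges. *)
Definition locally_cayley Y := forall y : Y, exists h : Y -> G,
  [/\ forall u, cnbr y u -> h u \in A,
      forall u v, cnbr y u -> cnbr y v -> h u = h v -> u = v &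
      forall u v, cnbr y u -> cnbr y v -> cnbr u v -> (h u)^-1 * h v \in A].

Lemma ball_le k l g : (k <= l)%N -> ball k g -> ball l g.
Proof.
by move=> kl [w [wA wg wk]]; exists w; split=> //; exact: leq_trans kl.
Qed.

Lemma ball0 k : ball k 1.
Proof. by exists [::]; rewrite big_nil. Qed.

Lemma ball1 k a : a \in A -> ball k.+1 a.
Proof. by move=> aA; exists [:: a]; rewrite /= aA big_seq1. Qed.

Lemma ballM k l g h : ball k g -> ball l h -> ball (k + l) (g * h).
Proof.
move=> [w [wA <- wk]] [v [vA <- vl]]; exists (w ++ v).
by rewrite all_cat wA vA big_cat size_cat leq_add.
Qed.

Lemma ballSr k g a : ball k g -> a \in A -> ball k.+1 (g * a).
Proof. by move=> gk aA; rewrite -addn1; apply: ballM => //; exact: ball1. Qed.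

Lemma ballSl k g a : ball k g -> a \in A -> ball k.+1 (a * g).
Proof. by move=> gk aA; rewrite -add1n; apply: ballM => //; exact: ball1. Qed.

Lemma ballSP k g : ball k.+1 g ->
  exists h a, [/\ ball k h, a \in A & g = h * a].
Proof.
move=> [w [+ <-]]; case/lastP: w => [_ _|w a].
  by exists 1, 1; split; rewrite ?big_nil ?mulg1 //; exact: ball0.
rewrite all_rcons => /andP[aA wA]; rewrite size_rcons => wk.
by exists (\prod_(b <- w) b), a; split=> //; [exists w | rewrite big_rcons].
Qed.

Lemma local_covering_le k l Y (F : G -> Y) :
  (k <= l)%N -> local_covering l F -> local_covering k F.
Proof. by move=> kl Fl g gk; apply: Fl; exact: ball_le gk. Qed.

Lemma star_inj_shift Y (F : G -> Y) g h :
  star_inj F (g * h) -> star_inj (fun x => F (g * x)) h.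
Proof.
move=> [Fe Fi]; split=> [a aA|a b aA bA]; rewrite !mulgA; first exact: Fe.
exact: Fi.
Qed.

Lemma local_covering_shift k Y (F : G -> Y) a : a \in A ->
  local_covering k.+1 F -> local_covering k (fun x => F (a * x)).
Proof.
by move=> aA Fk g gk; apply: star_inj_shift; apply: Fk; exact: ballSl.
Qed.

Section Locally.
Variable Y : graph.
Hypothesis locY : locally_cayley Y.
Implicit Types F : G -> Y.

(** Through the embedding [h], [F] induces an injection of the finite set [A] into itself, which is
    onto. *)
Lemma star_inj_surj F g u : star_inj F g -> cnbr (F g) u ->
  exists2 a, a \in A & F (g * a) = u.
Proof.
move=> [Fe Fi] gu; have [h [hA hi _]] := locY (F g).
have [a b aA bA /hi e|a aA||a aA /hi e] :=
  @inj_in_seq_surj _ A (fun a => h (F (g * a))) _ _ (h u).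
- by apply: Fi => //; apply: e; exact: Fe.
- by apply: hA; exact: Fe.
- exact: hA.
- by exists a => //; apply: e => //; exact: Fe.
Qed.

(* F induces an injection on the edges between the neighbours of g, which is a
   bijection as there are not more such edges at F g. *)
Lemma star_link F g : star_inj F g -> {in A, forall a, star_inj F (g * a)} ->
  {in A &, forall a b, cnbr (F (g * a)) (F (g * b)) -> a^-1 * b \in A}.
Proof.
move=> [Fe Fi] Fs a b aA bA ab; have [h [hA hi hl]] := locY (F g).
pose th c := h (F (g * c)).
have thi c d : c \in A -> d \in A -> th c = th d -> c = d.
  by move=> cA dA /hi e; apply: Fi => //; apply: e; exact: Fe.
pose E := [seq p <- [seq (c, d) | c <- A, d <- A] | p.1^-1 * p.2 \in A].
have memE c d : ((c, d) \in E) = [&& c^-1 * d \in A, c \in A & d \in A].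
  rewrite mem_filter /=; congr andb.
  by apply/allpairsP/andP => [[[? ?]] [? ? [-> ->]]//|[cA dA]]; exists (c, d).
have thE p : p \in E -> (th p.1, th p.2) \in E.
  case: p => c d; rewrite !memE /= => /and3P[cd cA dA].
  rewrite !hA ?Fe// !andbT; apply: hl; rewrite ?Fe//.
  by have [/(_ _ cd)] := Fs c cA; rewrite -mulgA mulVKg.
have [|p /thE//||] :=
  @inj_in_seq_surj _ E (fun p => (th p.1, th p.2)) _ _ (th a, th b).
- case=> c d [c' d']; rewrite !memE /= => /and3P[_ cA dA] /and3P[_ cA' dA'].
  by case=> /thi -> // /thi ->.
- by rewrite memE hl ?hA ?Fe.
move=> [c d]; rewrite memE => /and3P[cd cA dA] [/= /thi ec /thi ed].
by rewrite -ec // -ed.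
Qed.

End Locally.
End LocalCoverings.

(** * Distances and balls of half-integral radius *)

Section GraphDistance.

Lemma gdist_eq1 (V : Type) (e : rel V) u v : gdist e u v = 1%N -> e u v.
Proof.
rewrite /gdist; set P := (X in least X).
have [exP|noP] := EM (exists n, P n); last first.
  rewrite /least; case: pselect => [h|//].
  by case: noP; case: h => n /asboolP Pn; exists n.
have [Pl _] := leastP exP; move=> l1; move: Pl; rewrite l1.
by case=> -[|w [|? ?]] [] //= /andP[uw _] <-.
Qed.

Lemma gdist1 (V : Type) (e : rel V) u v : u <> v -> e u v -> gdist e u v = 1%N.
Proof.
move=> uv euv; rewrite /gdist; set P := (X in least X).
have P1 : P 1%N by exists [:: v]; rewrite /= euv.
have [Pl lmin] := leastP (ex_intro P _ P1).
move: Pl (lmin _ P1); case: (least P) => [|[]] //.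
by case=> -[|? ?] [] //= _ /uv.
Qed.

Variable Y : graph.
Implicit Types y u v : Y.

Lemma dist_leP n u v :
  (dist u v <= n)%N <->
  exists p, [/\ path (@adj Y) u p, last u p = v & (size p <= n)%N].
Proof.
rewrite /dist /gdist; set P := (X in least X).
have [|[p [pp pl ps]] lmin] := @leastP P.
  by have [p [pp pl]] := adj_connected u v; exists (size p), p.
split=> [len|[q [qp ql qn]]]; first by exists p; rewrite ps.
by apply: leq_trans qn; apply: lmin; exists q.
Qed.

Lemma dist_refl u : dist u u = 0%N.
Proof. by apply/eqP; rewrite -leqn0; apply/dist_leP; exists [::]. Qed.

Lemma dist_adj u v w : adj v w -> (dist u w <= (dist u v).+1)%N.
Proof.
move=> vw; apply/dist_leP.
have [p [pp pl ps]] := (dist_leP _ u v).1 (leqnn _).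
by exists (rcons p w); rewrite rcons_path last_rcons size_rcons pp pl.
Qed.

Lemma adj_dist1 u v : adj u v <-> dist u v = 1%N.
Proof.
split=> [uv|]; last exact: gdist_eq1.
apply: gdist1 => // e.
by move: uv; rewrite e adj_irr.
Qed.

Lemma dist_cnbr u v w : cnbr v w -> (dist u w <= (dist u v).+1)%N.
Proof. by case/orP => [/eqP->|]; [exact: leqnSn | exact: dist_adj]. Qed.

End GraphDistance.

Section HalfIntegerBalls.
Import Order.TTheory GRing.Theory Num.Theory.
Variables (K : realType) (n : nat).

(* At a half-integral radius, no edge between two vertices of the ball is
   excluded from the ball. *)
Definition half_radius : K := (n%:R + 2^-1)%R.

Lemma gball_half (X : graph) (x u : X) :
  gball x half_radius u <-> (dist x u <= n)%N.
Proof.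
rewrite /gball /half_radius /=; split=> [|un]; last first.
  have : ((dist x u)%:R <= n%:R :> K)%R by rewrite ler_nat.
  by lra.
rewrite leqNgt => h; apply/negP; rewrite -(ler_nat K) => nu.
by move: nu h; rewrite -natr1; lra.
Qed.

Lemma ball_adj_half (X : graph) (x u v : X) :
  (dist x u <= n)%N -> (dist x v <= n)%N ->
  ball_adj x half_radius u v = adj u v.
Proof.
rewrite /ball_adj /half_radius -!(ler_nat K) !natrD => un vn.
by rewrite [X in _ && X](_ : _ = true) ?andbT //; lra.
Qed.

Lemma ball_isometry_half (X Y : graph) (x : X) (y : Y) (f : X -> Y) :
  ball_isometry x y half_radius f ->
  [/\ forall u, (dist x u <= n)%N -> (dist y (f u) <= n)%N,
      forall u v, (dist x u <= n)%N -> (dist x v <= n)%N -> f u = f v -> u = v,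
      forall w, (dist y w <= n)%N -> exists u, (dist x u <= n)%N /\ f u = w &
      forall u v, (dist x u <= n)%N -> (dist x v <= n)%N ->
        cnbr (f u) (f v) = cnbr u v].
Proof.
case=> -[ffun finj fsurj] fdist.
have fb u : (dist x u <= n)%N -> (dist y (f u) <= n)%N.
  by move=> /gball_half/ffun/gball_half.
have fi u v : (dist x u <= n)%N -> (dist x v <= n)%N -> f u = f v -> u = v.
  by move=> /gball_half xu /gball_half xv; apply: finj; rewrite inE.
split=> // [w /gball_half/fsurj[u /gball_half xu <-]|u v xu xv].
  by exists u.
have {}fdist :
    ball_dist y half_radius (f u) (f v) = ball_dist x half_radius u v.
  by apply: fdist; rewrite inE; exact/gball_half.
rewrite /cnbr; have [->|uv] := eqVneq u v; first by rewrite eqxx.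
have fuv : f u != f v by apply: contraNneq uv => /fi ->.
rewrite (negPf fuv) /=; apply/idP/idP => h.
  rewrite -(ball_adj_half xu xv); apply: gdist_eq1.
  rewrite -[LHS]fdist; apply: gdist1; first exact/eqP.
  by rewrite ball_adj_half ?fb.
rewrite -(ball_adj_half (fb _ xu) (fb _ xv)); apply: gdist_eq1.
rewrite [LHS]fdist; apply: gdist1; first exact/eqP.
by rewrite ball_adj_half.
Qed.

End HalfIntegerBalls.

(** * Rigidity *)

Section Rigidity.
Variables (G : groupType) (S A : seq G).
Hypotheses (uA : uniq A) (AV : {in A, forall a, a^-1 \in A}).
Hypotheses (S1 : 1 \in S) (SV : {in S, forall s, s^-1 \in S}).
Hypothesis SA : forall r s t, r \in S -> s \in S -> t \in S -> r * s * t \in A.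
Hypothesis sepA : forall r s t a, r \in S -> s \in S -> t \in S -> a \in A ->
  r * s * t != 1 -> a != 1 -> ntri A (r * s * t) = ntri A a ->
  a = r * s * t \/ a = (r * s * t)^-1.
Implicit Types (Y : graph) (a b c g r s t z : G).

Lemma S2A r s : r \in S -> s \in S -> r * s \in A.
Proof. by move=> rS sS; rewrite -[r * s]mulg1 SA. Qed.

Lemma S1A s : s \in S -> s \in A.
Proof. by move=> sS; rewrite -[s]mulg1 S2A. Qed.

Let A1 : 1 \in A := S1A S1.

Variable z : G.
Hypotheses (zS : z \in S) (zinf : infinite_order z).

Section Locally.
Variable Y : graph.
Hypothesis locY : locally_cayley A Y.
Implicit Types F : G -> Y.

(* Labels are read off the number of triangles on an edge, up to inversion. *)
Lemma color_preserved F F' g g' r s t :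
  star_inj A F g -> {in A, forall a, star_inj A F (g * a)} ->
  star_inj A F' g' -> {in A, forall a, star_inj A F' (g' * a)} ->
  F g = F' g' -> r \in S -> s \in S -> t \in S ->
  F' (g' * (r * s * t)) = F (g * (r * s * t)) \/
  F' (g' * (r * s * t)) = F (g * (r * s * t)^-1).
Proof.
move=> Fg Fs Fg' Fs' gg' rS sS tS.
(* [th] compares the labels of the same vertex of [Y] seen from [g'] and from [g]. By [star_link] it
   is an automorphism of the graph induced on [A], so it preserves the counts [ntri]. *)
have ex a : exists b, a \in A -> b \in A /\ F (g * b) = F' (g' * a).
  have [aA|] := boolP (a \in A); last by exists 1.
  have [|b bA e] := star_inj_surj locY (u := F' (g' * a)) Fg; last by exists b.
  by rewrite gg'; case: Fg' => /(_ a aA).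
have [th thP] := choice ex.
have thA a : a \in A -> th a \in A by case/thP.
have thF a : a \in A -> F (g * th a) = F' (g' * a) by case/thP.
have thi : {in A &, injective th}.
  move=> a b aA bA e; have [_] := Fg'; apply=> //.
  by rewrite -!thF// e.
have th1 : th 1 = 1.
  by have [_] := Fg; apply; rewrite ?thA// thF// !mulg1.
have thE a b : a \in A -> b \in A ->
    ((th a)^-1 * th b \in A) = (a^-1 * b \in A).
  move=> aA bA; apply/idP/idP => h.
    apply: (star_link locY Fg' Fs') => //; rewrite -!thF//.
    have [/(_ _ h)] := Fs _ (thA _ aA).
    by rewrite -mulgA mulVKg.
  apply: (star_link locY Fg Fs); rewrite ?thA// !thF//.
  have [/(_ _ h)] := Fs' _ aA.
  by rewrite -mulgA mulVKg.
have thp : perm_eq (map th A) A.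
  apply: uniq_perm => //; first by rewrite map_inj_in_uniq.
  move=> b; apply/mapP/idP => [[a aA ->]|bA]; first exact: thA.
  by have [a aA <-] := inj_in_seq_surj thi thA bA; exists a.
have thN a : a \in A -> ntri A (th a) = ntri A a.
  move=> aA; rewrite /ntri; have /permP <- := thp.
  by rewrite count_map; apply: eq_in_count => b bA /=; rewrite thE.
have tA := SA rS sS tS; rewrite -thF//.
have [->|t1] := eqVneq (r * s * t) 1; first by left; rewrite th1.
have th_t1 : th (r * s * t) != 1.
  by apply: contraNneq t1 => e; apply/eqP/thi; rewrite ?th1.
by have [->|->] := sepA rS sS tS (thA _ tA) t1 th_t1 (esym (thN _ tA));
  [left|right].
Qed.

Lemma color_preserved_at F F' k g g' r s t :
  local_covering A k.+1 F -> local_covering A k.+1 F' ->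
  ball A k g -> ball A k g' ->
  F g = F' g' -> r \in S -> s \in S -> t \in S ->
  F' (g' * (r * s * t)) = F (g * (r * s * t)) \/
  F' (g' * (r * s * t)) = F (g * (r * s * t)^-1).
Proof.
move=> Fk Fk' gk gk'; apply: color_preserved.
- by apply: Fk; exact: ball_le gk.
- by move=> a aA; apply: Fk; exact: ballSr.
- by apply: Fk'; exact: ball_le gk'.
- by move=> a aA; apply: Fk'; exact: ballSr.
Qed.

(** * Agreement on [S] implies agreement on [S * S] *)

Section Agree.
Variables F F' : G -> Y.
Hypotheses (F2 : local_covering A 2 F) (F2' : local_covering A 2 F').
Hypothesis FS : {in S, F =1 F'}.

Let b1 g : g \in A -> ball A 1 g. Proof. exact: ball1. Qed.

Let Finj g a b : ball A 1 g -> a \in A -> b \in A ->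
  F (g * a) = F (g * b) -> a = b.
Proof. by move=> /(ball_le (leqnSn 1))/F2[_]; apply. Qed.

Let F11 : F 1 = F' 1. Proof. exact: FS. Qed.

(** Labels are preserved up to inversion: read at the vertex [b], this gives
    [F' (b * a) = F (b * a^-1)]; read at 1, it gives [F ((b * a)^-1)]. Injectivity of [F] near 1
    identifies the two arguments. *)
Lemma disagree_inverts a b : a \in S -> b \in S -> F' (b * a) != F (b * a) ->
  b * a^-1 = a^-1 * b^-1 /\ F' (b * a) = F (b * a)^-1.
Proof.
move=> aS bS ne.
have e1 : F' (b * a) = F (b * a^-1).
  have := @color_preserved_at F F' 1 b b a 1 1
    F2 F2' (b1 (S1A bS)) (b1 (S1A bS)).
  move=> /(_ (FS bS) aS S1 S1); rewrite !mulg1 => -[e|//].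
  by rewrite e eqxx in ne.
have e2 : F' (b * a) = F (b * a)^-1.
  have := @color_preserved_at F F' 1 1 1 b a 1 F2 F2' (ball0 _ _) (ball0 _ _).
  move=> /(_ F11 bS aS S1); rewrite !mulg1 !mul1g => -[e|//].
  by rewrite e eqxx in ne.
split=> //; apply: (@Finj 1); rewrite ?mul1g.
- exact: ball0.
- by rewrite S2A ?SV.
- by rewrite S2A ?SV.
- by rewrite -e1 e2 invgM.
Qed.

(* The labels a and b would generate a quaternion group. *)
Lemma disagree_quaternion a b : a \in S -> b \in S -> F' (b * a) != F (b * a) ->
  [/\ a * b = b * a^-1, b * a = a * b^-1 & a * a = b * b].
Proof.
move=> aS bS ne; have [e1 e2] := disagree_inverts aS bS ne.
have ab : a * b = b^-1 * a.
  by apply: (@mulIg _ a^-1); apply: (@mulgI _ a^-1); rewrite !mulgA mulVg mul1g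
    mulgK -e1.
have ba : b * a = a * b^-1 by rewrite -[a in RHS](mulVKg b) -ab mulgA mulgK.
have ab' : a * b = b * a^-1.
  apply: (@Finj 1); rewrite ?mul1g ?S2A ?SV//; first exact: ball0.
  have := @color_preserved_at F F' 1 a a b^-1 1 1
    F2 F2' (b1 (S1A aS)) (b1 (S1A aS)).
  rewrite !mulg1 -ba invgK => /(_ (FS aS) (SV bS) S1 S1).
  case=> [e|<-]; first by rewrite e eqxx in ne.
  by rewrite e2 invgM e1.
by split=> //; apply: (@mulIg _ a^-1); apply: (@mulgI _ b^-1);
  rewrite mulgK -mulgA mulKg -ab.
Qed.

(** Conjugation by [b] inverts [a] but fixes [a * a = b * b], so [a ^+ 4 = 1]. *)
Lemma quaternion_infinite a b : a * b = b * a^-1 -> a * a = b * b ->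
  infinite_order a -> False.
Proof.
move=> ab aa ainf; have e : a * a = a^-1 * a^-1.
  apply: (@mulgI _ b); by rewrite {1}aa mulgA -aa -mulgA ab mulgA ab -mulgA.
have /eqP[] := ainf 4 isT.
by rewrite -[4%N]/(2 + 2)%N expgnDr !expg2 {1}e -!mulgA mulKg mulVg.
Qed.

(* Comparing F and F' at b * a through z, b * z and a * z shows that z would be
   inverted by a, b and b * a, hence equal to its inverse. *)
Lemma local_coverings_agree a b : a \in S -> b \in S -> F (b * a) = F' (b * a).
Proof.
move=> aS bS; apply/esym/eqP/negPn/negP => ne.
have [ab ba aa] := disagree_quaternion aS bS ne.
have [e1 e2] := disagree_inverts aS bS ne.
(* If [F] and [F'] agree at [x], the label from [x] to [b * a] must get inverted. As
   [F' (b * a) = F ((b * a)^-1)], injectivity of [F] at [x] identifies this inverse with [q]. *)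
have main x r s t q : x \in A -> F x = F' x -> r \in S -> s \in S -> t \in S ->
    x * (r * s * t) = b * a -> q \in A -> x * q = (b * a)^-1 ->
    (r * s * t)^-1 = q.
  move=> xA Fx rS sS tS xc qA xq.
  have := @color_preserved_at F F' 1 x x r s t
    F2 F2' (b1 xA) (b1 xA) Fx rS sS tS.
  rewrite xc => -[e|e]; first by rewrite e eqxx in ne.
  apply: (@Finj x); [exact: b1|by rewrite AV ?SA|by []|].
  by rewrite xq -e.
have zb : F (b * z) = F' (b * z).
  apply/esym/eqP/negPn/negP => /(disagree_quaternion zS bS)[h _ zz].
  exact: quaternion_infinite h zz zinf.
have za : F (a * z) = F' (a * z).
  apply/esym/eqP/negPn/negP => /(disagree_quaternion zS aS)[h _ zz].
  exact: quaternion_infinite h zz zinf.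
have zVS := SV zS.
have E1 : (z^-1 * b * a)^-1 = z^-1 * b * a^-1.
  apply: (main z _ _ _ _ (S1A zS) (FS zS) zVS bS aS).
  - by rewrite !mulgA mulgV mul1g.
  - by rewrite SA ?SV.
  - by rewrite !mulgA mulgV mul1g invgM e1.
have E2 : (z^-1 * a * 1)^-1 = z^-1 * a^-1.
  apply: (main (b * z) _ _ _ _ (S2A bS zS) zb zVS aS S1).
  - by rewrite mulg1 -mulgA mulVKg.
  - by rewrite S2A ?SV.
  - by rewrite -mulgA mulVKg invgM e1.
have E3 : (z^-1 * b^-1 * 1)^-1 = z^-1 * b.
  apply: (main (a * z) _ _ _ _ (S2A aS zS) za zVS (SV bS) S1).
  - by rewrite mulg1 -mulgA mulVKg ba.
  - by rewrite S2A ?SV.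
  - by rewrite -mulgA mulVKg invgM -e1.
have az : a^-1 * z^-1 = z * a^-1.
  apply: (@mulIg _ z); rewrite mulgVK -mulgA.
  by move: E2; rewrite mulg1 invgM invgK => ->; rewrite mulVKg.
have bz : b^-1 * z = z^-1 * b^-1.
  apply: (@mulgI _ b); apply: (@mulIg _ b); apply: (@mulIg _ z).
  rewrite mulVKg -mulgA; move: E3; rewrite mulg1 invgM !invgK => ->.
  by rewrite mulVKg !mulgA mulgVK mulgVK.
have /eqP[] := zinf (isT : (0 < 2)%N).
apply: (@mulIg _ (a^-1 * b^-1)); apply: (@mulgI _ z^-1).
rewrite mul1g expg2 -!mulgA mulKg mulgA -az -mulgA -bz -e1 mulgA.
by move: E1; rewrite !invgM invgK -!mulgA => ->.
Qed.

End Agree.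

(** Translating by the first letter of [w] costs one unit of radius and keeps agreement on [S], by
    [local_coverings_agree]. *)
Lemma local_coverings_agree_words k F F' w : all (mem S) w -> (size w <= k)%N ->
  local_covering A k.+2 F -> local_covering A k.+2 F' -> {in S, F =1 F'} ->
  {in S, forall s, F (\prod_(t <- w) t * s) = F' (\prod_(t <- w) t * s)}.
Proof.
elim: w k F F' => [|t w IH] k F F' /=.
  by move=> _ _ _ _ FS s sS; rewrite big_nil mul1g FS.
case/andP=> tS wS; case: k => // k wk Fk Fk' FS s sS.
rewrite big_cons -mulgA.
apply: (IH k (fun g => F (t * g)) (fun g => F' (t * g))) => //.
- by apply: local_covering_shift => //; exact: S1A.
- by apply: local_covering_shift => //; exact: S1A.
move=> r rS; apply: local_coverings_agree => //.
- exact: local_covering_le Fk.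
- exact: local_covering_le Fk'.
Qed.

End Locally.

(** * Global coverings: uniqueness, extension of germs, discreteness *)

Hypothesis genS : forall g, exists w, all (mem S) w /\ \prod_(s <- w) s = g.

Section GlobalCoverings.
Variable Y : graph.
Hypothesis locY : locally_cayley A Y.
Implicit Types F : G -> Y.

Lemma coverings_agree F F' : (forall k, local_covering A k F) ->
  (forall k, local_covering A k F') -> {in S, F =1 F'} -> F =1 F'.
Proof.
move=> Fk Fk' FS g; have [w [wS <-]] := genS g.
rewrite -[\prod_(s <- w) s]mulg1.
exact: (local_coverings_agree_words locY wS (leqnn _)).
Qed.
End GlobalCoverings.

Variable genA : symmetric_generating A.
Notation X := (cayley genA).

Lemma cnbr_cayley (g h : X) : cnbr g h = (g^-1 * h \in A).
Proof.
rewrite /cnbr /= /cayley_adj; case: eqVneq => //= <-.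
by rewrite mulVg A1.
Qed.

Lemma cayley_locally_cayley : locally_cayley A X.
Proof.
move=> y; exists (fun u : G => y^-1 * u); split=> [u|u v _ _|u v _ _].
- by rewrite cnbr_cayley.
- exact: mulgI.
- by rewrite cnbr_cayley invgM invgK -mulgA mulVKg.
Qed.

Lemma covering_id k : local_covering A k (fun g => g : X).
Proof.
move=> g _; split=> [a aA|a b _ _]; last exact: mulgI.
by rewrite cnbr_cayley mulKg.
Qed.

Lemma color_preserved_id (psi : G -> X) k s : local_covering A k.+1 psi ->
  psi 1 = 1 -> s \in S -> psi s = s \/ psi s = s^-1.
Proof.
move=> psik psi1 sS.
have := color_preserved_at cayley_locally_cayley (covering_id (k := k.+1)) psik
  (ball0 _ _) (ball0 _ _) (esym psi1) sS S1 S1.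
by rewrite !mulg1 !mul1g.
Qed.

(* A germ on S is recorded by the set of labels that it inverts; the finitely
   many germs that do not extend to a global covering stop extending at some
   finite radius, and the others extend by uniqueness of the extensions. *)
Lemma local_covering_extends : exists k0, forall psi : G -> X,
  local_covering A k0 psi -> psi 1 = 1 ->
  exists Psi : G -> X, (forall k, local_covering A k Psi) /\ {in S, Psi =1 psi}.
Proof.
pose Q (e : {ffun seq_sub S -> bool}) k := exists psi : G -> X,
  local_covering A k psi /\
  forall s : seq_sub S, psi (val s) = if e s then (val s)^-1 else val s.
have Qle e k l : (k <= l)%N -> Q e l -> Q e k.
  by move=> kl [psi [psil psiS]]; exists psi; split=> //;
    exact: local_covering_le psil.
have exk e : exists k, Q e k -> forall l, Q e l.
  have [all|/existsNP[k nQ]] := EM (forall l, Q e l); first by exists 0%N.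
  by exists k => /nQ.
have [kf kfP] := choice exk.
exists (maxn 1 (\max_e kf e)) => psi psik psi1.
pose e := [ffun s : seq_sub S => psi (val s) != val s].
have psiE (s : seq_sub S) : psi (val s) = if e s then (val s)^-1 else val s.
  rewrite ffunE; case: eqP => //= ne.
  have := @color_preserved_id psi 0 (val s) (local_covering_le _ psik) psi1
    (valP s).
  by rewrite leq_maxl => /(_ isT)[].
have {}/choice[f fP] : forall l, Q e l.
  apply: (kfP e); exists psi; split=> //; apply: local_covering_le psik.
  by rewrite leq_max (leq_bigmax e) orbT.
have fS l s : s \in S -> f l s = psi s.
  move=> sS; have [_ /(_ (SeqSub sS)) /= ->] := fP l.
  by rewrite -(psiE (SeqSub sS)).
have [wd wdP] := choice genS.
pose len g := size (wd g).
(* All [f l] have the germ of [psi] on [S], so by uniqueness their values at [g] coincide for all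
   large [l]. *)
have agree g k l : (len g <= k)%N -> (len g <= l)%N -> f k.+2 g = f l.+2 g.
  have [wS wg] := wdP g.
  wlog kl : k l / (k <= l)%N.
    by move=> H gk gl; case: (leqP k l) => [kl|/ltnW kl]; [|symmetry]; exact: H.
  move=> gk _; rewrite -wg -[\prod_(s <- _) s]mulg1.
  apply: (local_coverings_agree_words cayley_locally_cayley wS gk) => //.
  - by have [] := fP k.+2.
  - by have [+ _] := fP l.+2; exact: local_covering_le.
  - by move=> s sS; rewrite !fS.
exists (fun g => f (len g).+2 g); split=> [k g gk|s sS]; last exact: fS.
(* The single map [f m.+2] computes the limit at [g] and at all its neighbours, and transfers the
   covering condition to it. *)
pose m := maxn k (maxn (len g) (\max_(a <- A) len (g * a)%g)).
have eg : f (len g).+2 g = f m.+2 g.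
  by apply: agree; rewrite // !leq_max leqnn !orbT.
have ega a : a \in A -> f (len (g * a)).+2 (g * a) = f m.+2 (g * a).
  move=> aA; apply: agree => //.
  by rewrite !leq_max (leq_bigmax_seq _ aA) ?orbT.
have [fm _] := fP m.+2; have [|fe fi] := fm g.
  apply: ball_le gk.
  by rewrite -addn2 (leq_trans (leq_maxl _ _) (leq_addr _ _)).
split=> [a aA|a b aA bA]; first by rewrite eg ega//; exact: fe.
by rewrite !ega//; exact: fi.
Qed.

Lemma isometry_covering (f : X -> X) k :
  Defs.isometry f -> local_covering A k f.
Proof.
move=> [[_ finj _] fdist] g _; split=> [a aA|a b _ _ e].
  rewrite /cnbr; have [//|ne] /= := eqVneq (f g) (f (g * a)).
  have : cnbr (g : X) (g * a) by rewrite cnbr_cayley mulKg.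
  case/orP => [/eqP e|]; first by rewrite -e eqxx in ne.
  by move/adj_dist1; rewrite -fdist => /adj_dist1.
by apply: (@mulgI _ g); apply: finj; rewrite ?inE.
Qed.

(** Isometries are local coverings of every radius, hence determined by their values on [S];
    prescribing these finitely many values defines a neighbourhood of [f]. *)
Lemma cayley_discrete : discrete_isometry_group X.
Proof.
move=> f isof; split; first exact/mem_set.
pose V (l : seq G) : set {ptws X -> discrete_topology X} :=

  [set g | {in l, forall s, g s = f s}]%classic.
have fV l : nbhs f (V l).
  elim: l => [|s l IH]; first exact: filterS filterT.
  have Vs : nbhs f
      [set g : {ptws X -> discrete_topology X} | g s = f s]%classic.
    apply: (@proj_continuous X (fun=> discrete_topology X) s f
      [set f s]%classic).
    exact/principal_filterP.
  apply: filterS (filterI Vs IH) => g [gs gl] t; rewrite inE.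
  by case/predU1P => [->//|]; exact: gl.
exists (V S) => //.
rewrite eqEsubset; split=> [g [gS isog]|g ->]; last by [].
apply/funext; apply: (coverings_agree cayley_locally_cayley) => [k|k|s sS].
- exact: isometry_covering.
- exact: isometry_covering.
- exact: gS.
Qed.

(** * Balls and coverings of the Cayley graph *)

Lemma ball_distP k (x u : X) : (dist x u <= k)%N <-> ball A k (x^-1 * u).
Proof.
rewrite cayley_dist /word_length; set P := (X in least X).
have [|[w [wA wg wl]] lmin] := @leastP P.
  by have [w [wA wg]] := proj2 genA (x^-1 * u); exists (size w), w.
split=> [lk|[v [vA vg vk]]]; first by exists w; rewrite wl.
by apply: leq_trans vk; apply: lmin; exists v.
Qed.

Lemma ball_seq k : exists l : seq G, forall g, g \in l <-> ball A k g.
Proof.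
elim: k => [|k [l IH]].
  exists [:: 1] => g; rewrite inE; split=> [/eqP->|[[|? ?] [_ <- //]]].
    exact: ball0.
  by rewrite big_nil eqxx.
exists [seq h * a | h <- l, a <- A] => g; split.
  by case/allpairsP => -[h a] /= [/IH hk aA ->]; exact: ballSr.
by case/(ballSP A1) => h [a [/IH hl aA ->]]; exact: allpairs_f.
Qed.

Lemma covering_star_inj (Z : graph) (phi : X -> Z) g :
  covering phi -> star_inj A phi g.
Proof.
case=> _ /(_ g) [phiE phiI _].
have adjE a : a \in A -> a <> 1 -> @adj X g (g * a)%g.
  move=> aA a1; have : cnbr (g : X) (g * a)%g by rewrite cnbr_cayley mulKg.
  by case/orP => // /eqP e; case: a1; apply: (@mulgI _ g); rewrite mulg1.
split=> [a aA|a b aA bA e].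
  have [->|/eqP a1] := eqVneq a 1; first by rewrite mulg1 /cnbr eqxx.
  by apply/orP; right; apply: phiE; exact: adjE.
have phi1 c : c \in A -> phi (g * c)%g = phi g -> c = 1.
  move=> cA ec; apply: contrapT => /(adjE _ cA)/phiE.
  by rewrite /= ec adj_irr.
have [a1|/eqP a1] := eqVneq a 1.
  by rewrite a1; apply/esym/phi1; rewrite // -e a1 mulg1.
have [b1|/eqP b1] := eqVneq b 1.
  by rewrite b1; apply/phi1; rewrite // e b1 mulg1.
by apply: (@mulgI _ g); apply: phiI => //; rewrite inE; exact: adjE.
Qed.

(** Surjectivity on vertices comes from lifting paths of the connected graph [Z], and on neighbours
    from counting. *)
Lemma star_inj_covering (Z : graph) (phi : X -> Z) : locally_cayley A Z ->
  (forall g, star_inj A phi g) -> covering phi.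
Proof.
move=> locZ phis; split.
  move=> y _; have [p [pp py]] := adj_connected (phi (1 : G)) y.
  elim: p (1 : G) pp py => [|v p IH] g /=; first by move=> _ <-; exists g.
  case/andP=> gv vp py.
  have [|a aA e] := star_inj_surj locZ (u := v) (phis g).
    by rewrite /cnbr gv orbT.
  by apply: (IH (g * a)%g); rewrite e.
move=> g; have [phiE phiI] := phis g.
have adjA (u : X) : adj g u -> g^-1 * u \in A.
  by move=> gu; rewrite -cnbr_cayley /cnbr gu orbT.
split=> [u /= gu|u v|v /= gv].
- have := phiE _ (adjA _ gu); rewrite mulVKg => /orP[/eqP e|//].
  have := phiI 1 (g^-1 * u) A1 (adjA _ gu); rewrite mulg1 mulVKg => /(_ e) e'.
  have ug : u = g by rewrite -[LHS](mulVKg g) -e' mulg1.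
  by move: gu; rewrite ug cayley_adj_irr.
- rewrite !inE => /adjA uA' /adjA vA' e; apply: (@mulgI _ g^-1).
  by apply: phiI; rewrite // !mulVKg.
- have [|a aA e] := star_inj_surj locZ (u := v) (phis g).
    by rewrite /cnbr gv orbT.
  exists (g * a)%g => //=.
  have : cnbr (g : X) (g * a)%g by rewrite cnbr_cayley mulKg.
  by case/orP => // /eqP e'; rewrite -e -e' adj_irr in gv.
Qed.

Section Composition.
Variables (Z : graph) (F : G -> Z) (Psi : G -> X) (k : nat).
Hypotheses (Fk : local_covering A k F) (Psik : local_covering A k Psi).
Hypothesis Psi1 : Psi 1 = 1.

Lemma local_covering_ball j g : (j <= k)%N -> ball A j g -> ball A j (Psi g).
Proof.
elim: j g => [|j IH] g jk.
  by case=> -[|? ?] [_ <- //] _; rewrite big_nil Psi1; exact: ball0.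
case/(ballSP A1) => h [a [hj aA ->]].
have [|Pe _] := Psik (g := h); first exact: ball_le (ltnW jk) hj.
rewrite -[Psi (h * a)](mulVKg (Psi h)).
apply: ballSr; first exact: IH (ltnW jk) hj.
by rewrite -cnbr_cayley Pe.
Qed.

Lemma local_covering_comp : local_covering A k (F \o Psi).
Proof.
move=> g gk; have [Pe Pi] := Psik gk.
have [Fe Fi] := Fk (local_covering_ball (leqnn k) gk).
have PA a : a \in A -> (Psi g)^-1 * Psi (g * a) \in A.
  by move=> aA; rewrite -cnbr_cayley Pe.
split=> [a aA|a b aA bA e] /=.
  by have := Fe _ (PA _ aA); rewrite mulVKg.
apply: Pi => //; apply: (@mulgI _ (Psi g)^-1); apply: Fi; rewrite ?PA//.
by rewrite !mulVKg.
Qed.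
End Composition.

(** * Charts of a graph that is locally the Cayley graph *)

Section LocallyLike.
Variables (K : realType) (n : nat) (Y : graph).
Hypothesis locY : locally_like (half_radius K n.+1) X Y.

Lemma ball_isometry_covering (x : X) (y : Y) (f : X -> Y) :
  ball_isometry x y (half_radius K n.+1) f ->
  local_covering A n (fun g => f (x * g)).
Proof.
case/ball_isometry_half=> _ fi _ fc g gn.
have dg : (dist x (x * g)%g <= n.+1)%N.
  by apply/ball_distP; rewrite mulKg; exact: ball_le gn.
have dga a : a \in A -> (dist x (x * (g * a))%g <= n.+1)%N.
  by move=> aA; apply/ball_distP; rewrite mulKg; exact: ballSr.
split=> [a aA|a b aA bA /fi e].
  by rewrite fc ?dga// cnbr_cayley [x * (g * a)]mulgA mulKg.
by do 2 apply: mulgI; apply: e; exact: dga.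
Qed.

Lemma ball_isometry_inverse (x : X) (y : Y) (f : X -> Y) :
  ball_isometry x y (half_radius K n.+1) f ->
  exists h : Y -> X, forall u, (dist y u <= n.+1)%N ->
    (dist x (h u) <= n.+1)%N /\ f (h u) = u.
Proof.
case/ball_isometry_half=> _ _ fs _.
suff /choice[h hP] : forall u, exists v,
    (dist y u <= n.+1)%N -> (dist x v <= n.+1)%N /\ f v = u by exists h.
move=> u.
have [/fs[v [xv <-]]|] := boolP (dist y u <= n.+1)%N; first by exists v.
by exists x.
Qed.

Lemma ball_isometry_inverse_cnbr (x : X) (y : Y) (f : X -> Y) (h : Y -> X) :
  ball_isometry x y (half_radius K n.+1) f ->
  (forall u, (dist y u <= n.+1)%N -> (dist x (h u) <= n.+1)%N /\ f (h u) = u) ->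
  forall u v, (dist y u <= n.+1)%N -> (dist y v <= n.+1)%N -> cnbr u v ->
  (h u)^-1 * h v \in A.
Proof.
case/ball_isometry_half=> _ _ _ fc hP u v yu yv.
have [[xu fu] [xv fv]] := (hP u yu, hP v yv).
by rewrite -{1}fu -{1}fv fc// cnbr_cayley.
Qed.

Lemma locally_like_locally_cayley : locally_cayley A Y.
Proof.
move=> y; have [x [f fiso]] := locY y.
have [h hP] := ball_isometry_inverse fiso.
have hc := ball_isometry_inverse_cnbr fiso hP.
have dy : (dist y y <= n.+1)%N by rewrite dist_refl.
have dyu u : cnbr y u -> (dist y u <= n.+1)%N.
  by move=> /(@dist_cnbr _ y); rewrite dist_refl => /leq_trans; apply.
exists (fun u => (h y)^-1 * h u).
split=> [u yu|u v yu yv /mulgI e|u v yu yv uv].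
- by apply: hc => //; exact: dyu.
- by have [[_ <-] [_ <-]] := (hP u (dyu _ yu), hP v (dyu _ yv)); rewrite e.
- by rewrite invgM invgK -mulgA mulVKg; apply: hc => //; exact: dyu.
Qed.

(* The inverse of the isometry may move the centre, but only within a set of
   vertices around which the ball is the same. *)
Lemma exists_chart (y : Y) : exists F : G -> Y,
  [/\ F 1 = y, local_covering A n F &
    forall g h, ball A n.+1 g -> ball A n.+1 h -> F g = F h -> g = h].
Proof.
have [x [f fiso]] := locY y; have [h hP] := ball_isometry_inverse fiso.
have hc := ball_isometry_inverse_cnbr fiso hP.
have [fb fi _ fc] := ball_isometry_half fiso.
have dy : (dist y y <= n.+1)%N by rewrite dist_refl.
(* [h] lifts paths that stay in the ball around [y], so it does not increase distances along
   geodesics from [y]. *)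
have hpath p u : (dist y u + size p <= n.+1)%N -> path (@adj Y) u p ->
    ball A (size p) ((h u)^-1 * h (last u p)).
  elim: p u => [|v p IH] u /=; first by rewrite mulVg => _ _; exact: ball0.
  rewrite addnS => ule /andP[uv vp].
  have yv : (dist y v + size p <= n.+1)%N.
    by apply: leq_trans ule; rewrite -addSn leq_add2r; exact: dist_adj.
  rewrite -[_ * _](_ : (h u)^-1 * h v * ((h v)^-1 * h (last v p)) = _);
    last by rewrite -mulgA mulVKg.
  apply: ballSl; first exact: IH.
  apply: hc; last by rewrite /cnbr uv orbT.
  - by apply: ltnW; apply: leq_ltn_trans ule; exact: leq_addr.
  - by apply: leq_trans yv; rewrite leq_addr.
pose w := h y; have [xw fw] := hP y dy.
have sub u : (dist x u <= n.+1)%N -> ball A n.+1 (w^-1 * u).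
  move=> xu; have [p [yp pu pn]] := (dist_leP _ _ _).1 (fb _ xu).
  have [xhu fhu] := hP _ (fb _ xu).
  rewrite -[u](fi _ _ xhu xu fhu) -pu.
  by apply: (ball_le pn); apply: hpath; rewrite ?dist_refl.
have [l lP] := ball_seq n.+1.
(* By [sub], translation by [w^-1 * x] carries the finite ball around 1 injectively into itself,
   hence onto: the balls around [x] and [w] coincide. *)
have balls g : ball A n.+1 g -> (dist x (w * g)%g <= n.+1)%N.
  move=> /lP gl; pose th c := w^-1 * (x * c).
  have [|c /lP cn||c /lP cn <-] := @inj_in_seq_surj _ l th _ _ g.
  - by move=> c d _ _ /mulgI/mulgI.
  - by apply/lP/sub/ball_distP; rewrite mulKg.
  - by [].
  - by rewrite /th mulVKg; apply/ball_distP; rewrite mulKg.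
exists (fun g => f (w * g)); split=> [|g gn|g g' gn gn' /fi e].
- by rewrite mulg1.
- split=> [a aA|a b aA bA /fi e].
    rewrite fc ?cnbr_cayley; first by rewrite [w * (g * a)]mulgA mulKg.
      by apply: balls; exact: ball_le gn.
    by apply: balls; exact: ballSr.
  by do 2 apply: mulgI; apply: e; apply: balls; exact: ballSr.
- by apply: mulgI; apply: e; exact: balls.
Qed.

(** * Continuation of charts *)

Section Development.
Variable k0 : nat.
Hypotheses (k0n : (k0 < n)%N) (n2 : (2 < n)%N).
Hypothesis k0P : forall psi : G -> X, local_covering A k0 psi -> psi 1 = 1 ->
  exists Psi : G -> X, (forall k, local_covering A k Psi) /\ {in S, Psi =1 psi}.

Let lcY := locally_like_locally_cayley.

(** The image under [F] of a path from 1 to [g] is lifted edge by edge through [F'], which is onto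
    on stars. *)
Lemma local_covering_lift (F F' : G -> Y) k g : F 1 = F' 1 ->
  local_covering A k F -> local_covering A k F' -> ball A k.+1 g ->
  exists g', ball A k.+1 g' /\ F' g' = F g.
Proof.
move=> F11 Fk Fk'; move: (leqnn k.+1); move: {1 3 4}k.+1 => j.
elim: j g => [|j IH] g jk.
  case=> -[|? ?] [_ <- //] _; exists 1; rewrite big_nil; split=> //.
  exact: ball0.
case/(ballSP A1) => h [a [hj aA ->]]; have [h' [hj' e]] := IH _ (ltnW jk) hj.
have [Fe _] := Fk _ (ball_le (jk : (j <= k)%N) hj).
have [|a' aA' e'] := star_inj_surj lcY (u := F (h * a))
  (Fk' _ (ball_le (jk : (j <= k)%N) hj')).
  by rewrite e Fe.
by exists (h' * a'); split=> //; exact: ballSr.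
Qed.

(* A chart around [F s] differs from [F (s * _)] by a local covering of X,
   which can be replaced by a global one without changing it on S. *)
Lemma local_covering_step (F : G -> Y) s : local_covering A n F -> s \in S ->
  exists F' : G -> Y, local_covering A n F' /\
    {in S, forall t, F' t = F (s * t)}.
Proof.
case: n k0n locY exists_chart => // m k0m _ chart Fn sS.
have sA := S1A sS.
have F1m : local_covering A m (fun g => F (s * g)).
  exact: local_covering_shift.
have [C [C1 Cm Ci]] := chart (F s).
have F1C : F (s * 1) = C 1 by rewrite mulg1.
have ex g : exists g', ball A m.+1 g -> ball A m.+1 g' /\ C g' = F (s * g).
  have [gm|ngm] := EM (ball A m.+1 g); last by exists 1.
  have [g' g'P] := local_covering_lift F1C F1m
    (local_covering_le (leqnSn m) Cm) gm.
  by exists g'.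
have [psi psiP] := choice ex.
have psib g : ball A m.+1 g -> ball A m.+1 (psi g) by move=> /psiP[].
have psiC g : ball A m.+1 g -> C (psi g) = F (s * g) by move=> /psiP[].
have psi1 : psi 1 = 1.
  apply: Ci; [exact: ball_le (psib _ (ball0 _ _))|exact: ball0|].
  by rewrite psiC ?F1C//; exact: ball0.
have psim : local_covering A m (psi : G -> X).
  move=> g gm; have gm1 : ball A m.+1 g by exact: ball_le gm.
  have [Fe Fi] := F1m _ gm.
  split=> [a aA|a b aA bA e]; last first.
    by apply: Fi => //; rewrite -!psiC ?e//; exact: ballSr.
  have [|a' aA' e] := star_inj_surj lcY (u := F (s * (g * a)))
    (Cm _ (psib _ gm1)).
    by rewrite psiC//; exact: Fe.
  rewrite (_ : psi (g * a) = psi g * a') ?cnbr_cayley ?mulKg//.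
  (* [psi g * a'] may lie at distance [m.+2] from 1, the full radius on which [C] is known to be
     injective. *)
  apply: Ci; first by apply: ball_le (leqnSn _) _; apply: psib; exact: ballSr.
    by apply: ballSr => //; exact: psib.
  by rewrite e psiC//; exact: ballSr.
have [Psi [Psik PsiS]] := k0P (local_covering_le (k0m : (k0 <= m)%N) psim) psi1.
have Psi1 : Psi 1 = 1 by rewrite PsiS.
(* [Psi] is a covering at every radius, so the composite regains the unit of radius lost in
   translating by [s]. *)
exists (C \o Psi); split; first exact: local_covering_comp.
move=> t tS /=; rewrite PsiS// psiC//.
by apply: ball1; exact: S1A tS.
Qed.

Section Words.
Variables (q : nat) (gen : 'I_q -> G) (rels : seq (word 'I_q)).
Hypothesis gen_in : forall i, gen i \in S.
Hypothesis evalP : forall u v,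
  word_eval gen u = word_eval gen v <-> presented_eq rels u v.
Hypothesis size_rels : {in rels, forall w, (size w < n)%N}.

Definition letters (w : word 'I_q) : seq G :=
  [seq if l.2 then (gen l.1)^-1 else gen l.1 | l <- w].

Lemma prod_letters w : \prod_(s <- letters w) s = word_eval gen w.
Proof. by rewrite big_map. Qed.

Lemma letters_in w : all (mem S) (letters w).
Proof. by apply/allP => _ /mapP[[i b] _ ->] /=; case: b => //; exact: SV. Qed.

(** Choosing one continuation per chart and letter once and for all makes continuation along words a
    fold, compatible with concatenation. *)
Lemma exists_development : exists dev : (G -> Y) -> seq G -> G -> Y,
  [/\ forall F, dev F [::] = F,
      forall F u v, dev F (u ++ v) = dev (dev F u) v &
      forall F s, local_covering A n F -> s \in S ->
        local_covering A n (dev F [:: s]) /\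
        {in S, forall t, dev F [:: s] t = F (s * t)}].
Proof.
have ex (Fs : (G -> Y) * G) : exists F', local_covering A n Fs.1 ->
    Fs.2 \in S ->
    local_covering A n F' /\ {in S, forall t, F' t = Fs.1 (Fs.2 * t)}.
  case: Fs => F s /=.
  have [[Fn sS]|no] := EM (local_covering A n F /\ s \in S).
    by have [F' F'P] := local_covering_step Fn sS; exists F'.
  by exists F => Fn sS; case: no.
have [st stP] := choice ex.
exists (fun F w => foldl (fun F s => st (F, s)) F w); split=> //.
  by move=> F u v; rewrite foldl_cat.
by move=> F s; exact: (stP (F, s)).
Qed.

Section Dev.
Variable dev : (G -> Y) -> seq G -> G -> Y.
Hypothesis dev_nil : forall F, dev F [::] = F.
Hypothesis dev_cat : forall F u v, dev F (u ++ v) = dev (dev F u) v.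
Hypothesis dev1 : forall F s, local_covering A n F -> s \in S ->
  local_covering A n (dev F [:: s]) /\
  {in S, forall t, dev F [:: s] t = F (s * t)}.

Let dev_cons F s w : dev F (s :: w) = dev (dev F [:: s]) w.
Proof. by rewrite -dev_cat. Qed.

Let n2' : (2 <= n)%N := ltnW n2.

Lemma dev_local_covering F w : all (mem S) w -> local_covering A n F ->
  local_covering A n (dev F w).
Proof.
elim: w F => [|s w IH] F /=; first by rewrite dev_nil.
by case/andP=> sS wS Fn; rewrite dev_cons; apply: IH => //; case: (dev1 Fn sS).
Qed.

(** As long as one map [H] is a local covering around the whole word, continuation only translates
    [H], because agreement on [S] passes to the translates. *)
Lemma dev_near F H w : all (mem S) w -> local_covering A n F ->
  local_covering A (size w).+1 H -> {in S, F =1 H} ->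
  {in S, forall s, dev F w s = H (\prod_(t <- w) t * s)}.
Proof.
elim: w F H => [|t w IH] F H /=.
  by move=> _ _ _ FH s sS; rewrite dev_nil big_nil mul1g FH.
case/andP=> tS wS Fn Hw FH s sS; have [F'n F'S] := dev1 Fn tS.
rewrite dev_cons big_cons -mulgA.
apply: (IH _ (fun g => H (t * g))) => //.
  by apply: local_covering_shift => //; exact: S1A.
move=> r rS; rewrite F'S//; apply: (local_coverings_agree lcY) => //.
- exact: local_covering_le Fn.
- by apply: local_covering_le Hw.
Qed.

Lemma dev_congr F F' w : all (mem S) w -> local_covering A n F ->
  local_covering A n F' -> {in S, F =1 F'} -> {in S, dev F w =1 dev F' w}.
Proof.
elim: w F F' => [|t w IH] F F' /=; first by rewrite !dev_nil.
case/andP=> tS wS Fn Fn' FF'; rewrite !(dev_cons _ t w).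
have [[F1n F1S] [F1n' F1S']] := (dev1 Fn tS, dev1 Fn' tS).
apply: IH => // s sS; rewrite F1S// F1S'//.
apply: (local_coverings_agree lcY) => //.
- exact: local_covering_le Fn.
- exact: local_covering_le Fn'.
Qed.

Lemma dev_loop F w : all (mem S) w -> local_covering A n F ->
  \prod_(t <- w) t = 1 -> (size w < n)%N -> {in S, dev F w =1 F}.
Proof.
move=> wS Fn w1 wn s sS; rewrite (dev_near wS Fn (H := F))//; last first.
  exact: local_covering_le Fn.
by rewrite w1 mul1g.
Qed.

(** A relator or a cancelling pair is a loop shorter than [n], along which continuation returns to
    its initial germ by [dev_loop]; by [dev_congr], what follows depends on this germ only. *)
Lemma dev_presented F u v : presented_eq rels u v -> local_covering A n F ->
  {in S, dev F (letters u) =1 dev F (letters v)}.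
Proof.
have ins u' w v' : local_covering A n F -> \prod_(t <- letters w) t = 1 ->
    (size w < n)%N ->
    {in S, dev F (letters (u' ++ w ++ v')) =1 dev F (letters (u' ++ v'))}.
  move=> Fn w1 wn; rewrite /letters !map_cat !dev_cat.
  have Fu : local_covering A n (dev F (letters u')).
    by apply: dev_local_covering => //; exact: letters_in.
  apply: dev_congr => //; first exact: letters_in.
    by apply: dev_local_covering => //; exact: letters_in.
  by apply: dev_loop; rewrite ?size_map //; exact: letters_in.
elim=> {u v} [u|u v _ IH|u v w _ IHu _ IHv|u v a b|u v r rR] Fn s sS //.
- by rewrite IH.
- by rewrite IHu// IHv.
- rewrite -[(a, b) :: _]/([:: (a, b); (a, ~~ b)] ++ v) ins//.
  rewrite prod_letters /word_eval !big_cons big_nil mulg1 /=.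
  by case: b; rewrite /= ?mulVg ?mulgV.
- rewrite ins ?size_rels// prod_letters.
  have -> : 1 = word_eval gen [::] by rewrite /word_eval big_nil.
  by apply/evalP; have := PresRel [::] [::] rR; rewrite cats0.
Qed.
End Dev.

(** [phi g] is the value at 1 of the chart continued along a word for [g]. Around [g], [phi]
    coincides with that chart, since the germ reached depends only on the group element. *)
Lemma local_covering_develops (F : G -> Y) (wd : G -> word 'I_q) (r : nat) :
  (forall g, word_eval gen (wd g) = g) ->
  (forall g, ball A r.+1 g -> (size (wd g) < n)%N) ->
  local_covering A n F ->
  exists phi : G -> Y, (forall g, star_inj A phi g) /\
    forall g, ball A r.+1 g -> phi g = F g.
Proof.
move=> wdK wdn Fn; have [dev [dev_nil dev_cat dev1]] := exists_development.
have near F' g : local_covering A n F' -> ball A r.+1 g ->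
    dev F' (letters (wd g)) 1 = F' g.
  move=> Fn' gr.
  rewrite (dev_near dev_nil dev_cat dev1 (letters_in _) Fn' (H := F'))//.
    by rewrite prod_letters wdK mulg1.
  by apply: local_covering_le Fn'; rewrite size_map wdn.
pose phi g := dev F (letters (wd g)) 1.
exists phi; split=> [g|g gr]; last exact: near.
pose Fg := dev F (letters (wd g)).
have Fgn : local_covering A n Fg.
  by apply: (dev_local_covering dev_nil dev_cat dev1) => //; exact: letters_in.
have phig a : a \in A -> phi (g * a) = Fg a.
  move=> aA; rewrite -[RHS](near _ _ Fgn); last exact: ball1.
  rewrite /Fg -dev_cat -map_cat -/(letters _).
  apply: (dev_presented dev_nil dev_cat dev1) => //; apply/evalP.
  by rewrite wdK /word_eval big_cat /= -!/(word_eval _ _) !wdK.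
have [Fe Fi] := Fgn 1 (ball0 _ _).
have phi1 : phi g = Fg 1 by rewrite -(phig _ A1) mulg1.
split=> [a aA|a b aA bA]; rewrite ?phi1 !phig//.
  by have := Fe _ aA; rewrite mul1g.
by have := Fi _ _ aA bA; rewrite !mul1g.
Qed.
End Words.
End Development.
End LocallyLike.

(** * Rigidity of the Cayley graph *)

Lemma ball_bound (len : G -> nat) k :
  exists m, forall g, ball A k g -> (len g <= m)%N.
Proof.
have [l lP] := ball_seq k; exists (\max_(g <- l) len g) => g /lP gl.
exact: leq_bigmax_seq.
Qed.

Section Rigid.
Import Order.TTheory GRing.Theory Num.Theory.
Variables (K : realType) (q : nat) (gen : 'I_q -> G) (rels : seq (word 'I_q)).
Hypothesis gen_in : forall i, gen i \in S.
Hypothesis gen_onto : forall g, exists w, word_eval gen w = g.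
Hypothesis evalP : forall u v,
  word_eval gen u = word_eval gen v <-> presented_eq rels u v.

Lemma cayley_USLG_rigid : USLG_rigid K X.
Proof.
have [k0 k0P] := local_covering_extends.
have [wd wdK] := choice gen_onto.
(* For [r] at least 1 the ball around [x] contains [x * s] for all [s] in [S], which gives
   uniqueness. *)
exists 1%R => r r1.
pose k := Num.truncn r; have rk : (r < k.+1%:R)%R.
  by apply: real_truncnS_gt; rewrite realE (le_trans ler01 r1).
have [m mP] := ball_bound (fun g => size (wd g)) k.+1.
have [M MP] : exists M, {in rels, forall w, (size w <= M)%N}.
  by exists (\max_(w <- rels) size w) => w wr; exact: leq_bigmax_seq.
(* [n] has to exceed the lengths of the relators ([M]) and of the chosen words over the ball of
   radius [k.+1] ([m]), as well as [k0] and 2; with [k] in the sum, the radius is at least [r]. *)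
pose n := (k + m + k0 + 3 + M)%N.
exists (half_radius K n.+1); split.
- exact: lt_le_trans ltr01 r1.
- rewrite /half_radius (le_trans (ltW rk))//.
  have : (k.+1%:R <= n.+1%:R :> K)%R by rewrite ler_nat; lia.
  by lra.
move=> Y locY x y f fiso.
have lcY := locally_like_locally_cayley locY.
have F0 := ball_isometry_covering fiso.
have [||||phi0 [phi0s phi0E]] :=
  @local_covering_develops K n Y locY k0 _ _ k0P q gen rels gen_in evalP _
   _ wd k wdK _ F0.
- by rewrite /n; lia.
- by rewrite /n; lia.
- by move=> w /MP; rewrite /n; lia.
- by move=> g /mP; rewrite /n; lia.
pose phi (u : X) : Y := phi0 (x^-1 * u).
have phis g : star_inj A phi g.
  by have := phi0s (x^-1 * g) => -[Pe Pi]; split=> [a aA|a b aA bA];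
    rewrite /phi ![x^-1 * (g * _)]mulgA; [exact: Pe|exact: Pi].
have phiE u : (dist x u <= k.+1)%N -> phi u = f u.
  by move=> /ball_distP xu; rewrite /phi phi0E// mulVKg.
have gballk u : u \in gball x r -> (dist x u <= k.+1)%N.
  rewrite inE /gball /= => xu; rewrite -(ler_nat K).
  exact: ltW (le_lt_trans xu rk).
exists phi; split; first split.
- exact: star_inj_covering.
- by move=> u /gballk/phiE.
move=> phi' [cphi' phi'E]; apply/funext => u.
rewrite -[u](mulVKg x); move: (x^-1 * u); apply: (coverings_agree lcY).
- by move=> j g _; apply: (star_inj_shift (g := x)); exact: phis.
- by move=> j g _; apply: (star_inj_shift (g := x)); exact: covering_star_inj.
move=> s sS; have xs : (x * s : G) \in gball x r.
  rewrite inE /gball /=; apply: le_trans r1; rewrite -[1%R]/(1%:R)%R ler_nat.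
  by apply/ball_distP; rewrite mulKg; apply: ball1; exact: S1A.
by rewrite phi'E// phiE// gballk.
Qed.
End Rigid.

End Rigidity.

(** * Choice of the generators and conclusion *)

Lemma exists_rigid_cayley (G : groupType) (S0 : seq G) :
  (exists z : G, infinite_order z) ->
  (forall g, exists w : seq G,
     all (fun s => (s \in S0) || (s^-1 \in S0)) w /\ \prod_(s <- w) s = g) ->
  exists (A : seq G) (genA : symmetric_generating A),
    discrete_isometry_group (cayley genA) /\
    forall (K : realType) q (gen : 'I_q -> G) rels,
      (forall i, gen i \in S0) -> (forall g, exists w, word_eval gen w = g) ->
      (forall u v,
         word_eval gen u = word_eval gen v <-> presented_eq rels u v) ->
      USLG_rigid K (cayley genA).
Proof.
move=> exz S0gen; have [z zinf] := exz.
pose S := [:: 1; z; z^-1] ++ S0 ++ [seq s^-1 | s <- S0].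
have S1 : 1 \in S by rewrite !inE eqxx.
have zS : z \in S by rewrite !inE eqxx orbT.
have S0S : {subset S0 <= S} by move=> s sS; rewrite !mem_cat sS orbT.
have S0VS s : s^-1 \in S0 -> s \in S.
  move=> sS; rewrite !mem_cat; apply/orP; right; apply/orP; right.
  by apply/mapP; exists s^-1; rewrite ?invgK.
have SV : {in S, forall s, s^-1 \in S}.
  move=> s; rewrite !mem_cat => /or3P[|sS|/mapP[t tS ->]].
  - by rewrite !inE => /or3P[]/eqP->; rewrite ?invg1 ?invgK ?eqxx ?orbT.
  - by rewrite orbA; apply/orP; right; exact: map_f.
  - by rewrite invgK tS orbT.
pose T := [seq p * t | p <- [seq r * s | r <- S, s <- S], t <- S].
have ST r s t : r \in S -> s \in S -> t \in S -> r * s * t \in T.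
  by move=> rS sS tS; apply: allpairs_f => //; exact: allpairs_f.
have TP t : t \in T ->
    exists r s u, [/\ r \in S, s \in S, u \in S & t = r * s * u].
  case/allpairsP => -[p u] [/allpairsP[[r s] [rS sS ep]] uS ->].
  by exists r, s, u; rewrite -ep.
have T1 : 1 \in T by have := ST _ _ _ S1 S1 S1; rewrite !mulg1.
have TV : {in T, forall t, t^-1 \in T}.
  by move=> _ /TP[r [s [u [rS sS uS ->]]]]; rewrite !invgM mulgA ST ?SV.
have [A [uA TA AV sepA]] := triangles_separate T1 TV exz.
have SA r s t : r \in S -> s \in S -> t \in S -> r * s * t \in A.
  by move=> rS sS tS; exact/TA/ST.
have {}sepA r s t a : r \in S -> s \in S -> t \in S -> a \in A ->
    r * s * t != 1 -> a != 1 -> ntri A (r * s * t) = ntri A a ->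
    a = r * s * t \/ a = (r * s * t)^-1.
  by move=> rS sS tS aA; apply: sepA => //; exact: ST.
have genS g : exists w, all (mem S) w /\ \prod_(s <- w) s = g.
  have [w [wS <-]] := S0gen g; exists w; split=> //; apply: sub_all wS => s /=.
  by case/orP=> [/S0S|/S0VS].
have genA : symmetric_generating A.
  split=> // g; have [w [wS <-]] := genS g; exists w; split=> //.
  by apply: sub_all wS => s; exact: S1A.
exists A, genA; split=> [|K q gen rels genS0 onto evalP].
  exact: (cayley_discrete uA AV S1 SV SA sepA zS zinf genS).
apply: (cayley_USLG_rigid uA AV S1 SV SA sepA zS zinf genS _ _ _ onto evalP).
move=> i.
exact: S0S.
Qed.

Theorem theorem10 (K : realType) (G : groupType) :
  finitely_generated G ->
  (exists g : G, infinite_order g) ->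
  exists (S : seq G) (genS : symmetric_generating S),
    discrete_isometry_group (cayley genS) /\
    (finitely_presented G -> USLG_rigid K (cayley genS)).
Proof.
move=> [S0 S0gen] exz.
(* The graph has to be chosen before a presentation is given, so the case is decided classically;
   when [G] is finitely presented, the generators of a presentation serve as initial letters. *)
have [[q [gen [rels [onto evalP]]]]|nofp] := EM (finitely_presented G).
  have [g|A [genA [discA rigA]]] := @exists_rigid_cayley G (codom gen) exz.
    have [w <-] := onto g; exists (letters gen w); rewrite prod_letters.
    split=> //; apply/allP => _ /mapP[[i b] _ ->] /=.
    by case: b; rewrite ?invgK codom_f ?orbT.
  exists A, genA; split=> // _.
  by apply: rigA onto evalP => i; exact: codom_f.
have [A [genA [discA _]]] := exists_rigid_cayley exz S0gen.
by exists A, genA; split.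
Qed.
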